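(* Let $M$ be a compact (projective) algebraic manifold with an effective algebraic action of the torus $T=T^s$, let $K$ be the canonical bundle of $M$, and let $L$ be a very ample line bundle on $M$ such that the $T$-action on $M$ lifts to an action of $T$ on the total space of $L$. Then for every sufficiently large integer $k$ there are a nonzero holomorphic section $\sigma_1$ of $K\otimes L^{\otimes k}$ and a nonzero holomorphic section $\sigma_2$ of $L^{\otimes k}$ such that $\sigma=\sigma_1\otimes\sigma_2^{-1}$ is a meromorphic, $T$-invariant section of $K$.
   Context: $T^s=(S^1)^s$ is the real $s$-dimensional torus. It acts on $M$ by biholomorphisms; the action being algebraic is taken to mean that there is a very ample holomorphic line bundle $L$ on $M$ such that the action lifts to an action of $T$ on the total space of $L$ by holomorphic bundle automorphisms (linear on fibers). Manifolds are connected. The group $T$ acts on the canonical bundle $K$ by the natural induced action; $T$-invariance of the meromorphic section $\sigma$ of $K$ is with respect to this action. *)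

(* Defs.v *)
From HB Require Import structures.
From mathcomp Require Export all_boot all_order all_algebra.
From mathcomp Require Export complex.
From mathcomp Require Export all_classical all_reals all_analysis.

Set Implicit Arguments.
Unset Strict Implicit.
Unset Printing Implicit Defensive.

Export Order.TTheory GRing.Theory Num.Theory.
Export numFieldNormedType.Exports.

Local Open Scope classical_set_scope.
Local Open Scope ring_scope.

(* Complex numbers, packed as a numClosedFieldType so that the norm topology
   of num fields is inferred on them. *)
Definition Cx (R : realType) : numClosedFieldType := R[i].

(* C^1 with complex-linear differential (Hörmander's definition of holomorphic
   functions of several variables).  Differentiability is Fréchet
   differentiability over the scalar field [Cx R]; [U] is meant to be open. *)
Definition holomorphic_on (R : realType) (V W : normedModType (Cx R))
    (U : set V) (f : V -> W) : Prop :=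
  (forall z, U z -> differentiable f z) /\
  (forall v z, U z -> {for z, continuous (fun y => 'D_v f y)}).

(* [cm_param c] is the inverse of the chart [cm_chart c]; both are total
   functions, only meaningful on [cm_dom c] and on its image. *)
Record complex_manifold (R : realType) (n : nat) := ComplexManifold {
  cm_space :> topologicalType ;
  cm_hausdorff : hausdorff_space cm_space ;
  cm_second_countable : @second_countable cm_space ;
  cm_nonempty : [set: cm_space] !=set0 ;
  cm_connected : connected [set: cm_space] ;
  cm_idx : Type ;
  cm_dom : cm_idx -> set cm_space ;
  cm_chart : cm_idx -> cm_space -> 'rV[Cx R]_n ;
  cm_param : cm_idx -> 'rV[Cx R]_n -> cm_space ;
  cm_cover : forall x, exists c, cm_dom c x ;
  cm_dom_open : forall c, open (cm_dom c) ;
  cm_image_open : forall c, open (cm_chart c @` cm_dom c) ;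
  cm_chartK : forall c x, cm_dom c x -> cm_param c (cm_chart c x) = x ;
  cm_chart_continuous : forall c x, cm_dom c x ->
    {for x, continuous (cm_chart c)} ;
  cm_param_continuous : forall c z, (cm_chart c @` cm_dom c) z ->
    {for z, continuous (cm_param c)} ;
  cm_transition : forall c d,
    holomorphic_on (cm_chart c @` (cm_dom c `&` cm_dom d))
                   (cm_chart d \o cm_param c)
}.
Arguments cm_dom {R n c0} : rename.
Arguments cm_chart {R n c0} : rename.
Arguments cm_param {R n c0} : rename.

Definition holomorphic_fun_on (R : realType) (n : nat)
    (M : complex_manifold R n) (W : set M) (f : M -> Cx R) : Prop :=
  forall c : cm_idx M,
    holomorphic_on (cm_chart c @` (cm_dom c `&` W)) (f \o cm_param c).

Definition holomorphic_map (R : realType) (n : nat)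
    (M : complex_manifold R n) (f : M -> M) : Prop :=
  continuous f /\
  forall c d : cm_idx M,
    holomorphic_on (cm_chart c @` (cm_dom c `&` f @^-1` cm_dom d))
                   (cm_chart d \o f \o cm_param c).

(* Gluing data [g_ij = lb_trans i j] on an open cover. *)
Record bundle_data (R : realType) (n : nat) (M : complex_manifold R n) :=
  BundleData {
    lb_idx : Type ;
    lb_dom : lb_idx -> set M ;
    lb_trans : lb_idx -> lb_idx -> M -> Cx R
  }.
Arguments lb_dom {R n M b}.
Arguments lb_trans {R n M b}.

Record holomorphic_line_bundle (R : realType) (n : nat)
    (M : complex_manifold R n) (E : bundle_data M) : Prop :=
  HolomorphicLineBundle {
    lb_open : forall i : lb_idx E, open (lb_dom i) ;
    lb_cover : forall x, exists i : lb_idx E, lb_dom i x ;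
    lb_trans_neq0 : forall (i j : lb_idx E) x, lb_dom i x -> lb_dom j x ->
      lb_trans i j x != 0 ;
    lb_trans_holo : forall i j : lb_idx E,
      holomorphic_fun_on (lb_dom i `&` lb_dom j) (lb_trans i j) ;
    lb_cocycle : forall (i j k : lb_idx E) x,
      lb_dom i x -> lb_dom j x -> lb_dom k x ->
      lb_trans i j x * lb_trans j k x = lb_trans i k x
  }.

(* A vector of the fibre over [x] is the family of its coordinates in all the
   local trivialisations around [x], set to 0 for the other trivialisations so
   that equality of families is equality of vectors.  The total space of the
   bundle is thus the set of pairs [(x, v)] with [fibre E x v]. *)
Definition fibre (R : realType) (n : nat) (M : complex_manifold R n)
    (E : bundle_data M) (x : M) : set (lb_idx E -> Cx R) :=
  [set v | (forall i, ~ lb_dom i x -> v i = 0) /\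
           (forall i j, lb_dom i x -> lb_dom j x ->
              v i = lb_trans i j x * v j)].

(* The vector over [x] whose coordinate in the trivialisation [i] is 1. *)
Definition frame (R : realType) (n : nat) (M : complex_manifold R n)
    (E : bundle_data M) (i : lb_idx E) (x : M) : lb_idx E -> Cx R :=
  fun j => if `[< lb_dom j x >] then lb_trans j i x else 0.

Definition holomorphic_section_on (R : realType) (n : nat)
    (M : complex_manifold R n) (E : bundle_data M) (D : set M)
    (s : M -> lb_idx E -> Cx R) : Prop :=
  (forall x, D x -> fibre x (s x)) /\
  (forall i, holomorphic_fun_on (D `&` lb_dom i) (fun x => s x i)).

Definition holomorphic_section (R : realType) (n : nat)
    (M : complex_manifold R n) (E : bundle_data M)
    (s : M -> lb_idx E -> Cx R) : Prop :=
  holomorphic_section_on [set: M] s.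

Definition nonvanishing_locus (R : realType) (n : nat)
    (M : complex_manifold R n) (E : bundle_data M)
    (s : M -> lb_idx E -> Cx R) : set M :=
  [set x | exists i, s x i != 0].

Definition nonzero_section (R : realType) (n : nat)
    (M : complex_manifold R n) (E : bundle_data M)
    (s : M -> lb_idx E -> Cx R) : Prop :=
  nonvanishing_locus s !=set0.

Definition tensor_bundle (R : realType) (n : nat) (M : complex_manifold R n)
    (E F : bundle_data M) : bundle_data M :=
  @BundleData R n M (lb_idx E * lb_idx F)%type
    (fun p => lb_dom p.1 `&` lb_dom p.2)
    (fun p q x => lb_trans p.1 q.1 x * lb_trans p.2 q.2 x).

(* The image of the pure tensor of two vectors in the fibre of
   [tensor_bundle E F]. *)
Definition tensor (R : realType) (n : nat) (M : complex_manifold R n)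
    (E F : bundle_data M) (v : lb_idx E -> Cx R) (w : lb_idx F -> Cx R) :
    lb_idx (tensor_bundle E F) -> Cx R :=
  fun p => v p.1 * w p.2.

(* The k-th tensor power, over the same cover. *)
Definition power_bundle (R : realType) (n : nat) (M : complex_manifold R n)
    (E : bundle_data M) (k : nat) : bundle_data M :=
  @BundleData R n M (lb_idx E) lb_dom (fun i j x => lb_trans i j x ^+ k).

(* The bundle of holomorphic n-forms: the coordinate in the chart [c], with
   local coordinates z_1, ..., z_n, of an n-form is the coefficient f_c in
   f_c dz_1 /\ ... /\ dz_n, whence f_c = det (d z_d / d z_c) * f_d. *)
Definition canonical_bundle (R : realType) (n : nat)
    (M : complex_manifold R n) : bundle_data M :=
  @BundleData R n M (cm_idx M) cm_dom
    (fun c d x => \det (jacobian (cm_chart d \o cm_param c) (cm_chart c x))).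

(* [w'], an n-form at [x], is the pullback by [f] of [w], an n-form at
   [f x]. *)
Definition is_form_pullback (R : realType) (n : nat)
    (M : complex_manifold R n) (f : M -> M) (x : M)
    (w w' : lb_idx (canonical_bundle M) -> Cx R) : Prop :=
  forall c d : cm_idx M, cm_dom c x -> cm_dom d (f x) ->
    w' c = \det (jacobian (cm_chart d \o f \o cm_param c) (cm_chart c x)) * w d.

Definition H0_basis (R : realType) (n : nat) (M : complex_manifold R n)
    (L : bundle_data M) (m : nat) (s : 'I_m -> M -> lb_idx L -> Cx R) : Prop :=
  (forall j, holomorphic_section (s j)) /\
  (forall u, holomorphic_section u -> exists! a : 'rV[Cx R]_m,
     forall x i, u x i = \sum_(j < m) a 0 j * s j x i).

(* For some basis s_0, ..., s_N of H^0(M, L), the map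
   x |-> [s_0(x) : ... : s_N(x)] is everywhere defined, injective, and an
   immersion (read in the affine chart of P^N where the j-th homogeneous
   coordinate is nonzero); on a compact manifold this says that it is an
   embedding into P^N. *)
Definition very_ample (R : realType) (n : nat) (M : complex_manifold R n)
    (L : bundle_data M) : Prop :=
  exists (N : nat) (s : 'I_N.+1 -> M -> lb_idx L -> Cx R),
  [/\ H0_basis s,
      forall x, exists j i, s j x i != 0,
      forall x y (i i' : lb_idx L) (a : Cx R),
        lb_dom i x -> lb_dom i' y -> a != 0 ->
        (forall j, s j x i = a * s j y i') -> x = y
    & forall (x : M) (c : cm_idx M) (i : lb_idx L) (j : 'I_N.+1),
        cm_dom c x -> lb_dom i x -> s j x i != 0 ->
        \rank (jacobian
                 (fun z => \row_l (s l (cm_param c z) i / s j (cm_param c z) i))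
                 (cm_chart c x)) = n].

(* (S^1)^s; its unit is [const_mx 1]. *)
Definition torus (R : realType) (s : nat) : set 'rV[Cx R]_s :=
  [set t | forall j, `|t 0 j| = 1].

Definition torus_mul (R : realType) (s : nat) (t u : 'rV[Cx R]_s) :
    'rV[Cx R]_s := \row_j (t 0 j * u 0 j).

(* Continuous action by biholomorphisms; only the values of [a] on the torus
   matter. *)
Record holomorphic_torus_action (R : realType) (s n : nat)
    (M : complex_manifold R n) (a : 'rV[Cx R]_s -> M -> M) : Prop :=
  HolomorphicTorusAction {
    ta_one : forall x, a (const_mx 1) x = x ;
    ta_mul : forall t u x, torus t -> torus u ->
      a (torus_mul t u) x = a t (a u x) ;
    ta_holo : forall t, torus t -> holomorphic_map (a t) ;
    ta_continuous :
      {within [set p : 'rV[Cx R]_s * M | torus p.1],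
        continuous (fun p => a p.1 p.2)}
  }.

Definition effective_action (R : realType) (s n : nat)
    (M : complex_manifold R n) (a : 'rV[Cx R]_s -> M -> M) : Prop :=
  forall t, torus t -> (forall x, a t x = x) -> t = const_mx 1.

(* [(x, v) |-> (a t x, A t x v)] is a continuous action of the torus on the
   total space of [L] by holomorphic bundle automorphisms.  In the local
   trivialisations [i] at the source and [j] at the target, the fibrewise
   linear map [A t] is multiplication by [A t x (frame i x) j], so it is this
   coefficient that must be holomorphic in [x] and jointly continuous. *)
Record lifted_action (R : realType) (s n : nat) (M : complex_manifold R n)
    (a : 'rV[Cx R]_s -> M -> M) (L : bundle_data M)
    (A : 'rV[Cx R]_s -> M -> (lb_idx L -> Cx R) -> (lb_idx L -> Cx R)) : Prop :=
  LiftedAction {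
    la_fibre : forall t x v, torus t -> fibre x v -> fibre (a t x) (A t x v) ;
    la_linear : forall t x (b : Cx R) v w, torus t -> fibre x v -> fibre x w ->
      A t x (fun i => b * v i + w i) = (fun i => b * A t x v i + A t x w i) ;
    la_one : forall x v, fibre x v -> A (const_mx 1) x v = v ;
    la_mul : forall t u x v, torus t -> torus u -> fibre x v ->
      A (torus_mul t u) x v = A t (a u x) (A u x v) ;
    la_holo : forall t (i j : lb_idx L), torus t ->
      holomorphic_fun_on (lb_dom i `&` a t @^-1` lb_dom j)
                         (fun x => A t x (frame i x) j) ;
    la_continuous : forall i j : lb_idx L,
      {within [set p : 'rV[Cx R]_s * M |
                [/\ torus p.1, lb_dom i p.2 & lb_dom j (a p.1 p.2)]],
        continuous (fun p => A p.1 p.2 (frame i p.2) j)}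
  }.

(* [s], only meaningful on [D], is a holomorphic section of [E] over the dense
   open set [D] and is locally, in every trivialisation, a quotient f / g of
   holomorphic functions, g not vanishing identically on any nonempty open
   set. *)
Definition meromorphic_section (R : realType) (n : nat)
    (M : complex_manifold R n) (E : bundle_data M) (D : set M)
    (s : M -> lb_idx E -> Cx R) : Prop :=
  [/\ open D, dense D, holomorphic_section_on D s
    & forall (i : lb_idx E) (p : M), lb_dom i p ->
        exists (W : set M) (f g : M -> Cx R),
        [/\ open W, W p, W `<=` lb_dom i,
            holomorphic_fun_on W f /\ holomorphic_fun_on W g
          & (forall O : set M, open O -> O !=set0 -> O `<=` W ->
               exists2 x, O x & g x != 0) /\
            (forall x, W x -> D x -> g x * s x i = f x)]].

(* [s = s1 (x) s2^-1], as a section of [E] on the set where [s2 <> 0]. *)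
Definition is_section_quotient (R : realType) (n : nat)
    (M : complex_manifold R n) (E F : bundle_data M)
    (s : M -> lb_idx E -> Cx R)
    (s1 : M -> lb_idx (tensor_bundle E F) -> Cx R)
    (s2 : M -> lb_idx F -> Cx R) : Prop :=
  forall x, nonvanishing_locus s2 x ->
    fibre x (s x) /\ tensor (s x) (s2 x) = s1 x.

(* The torus acts on n-forms by t . w = (a t^-1)^* w, so invariance of [s]
   reads (a t)^* s = s for all t; as an equality of meromorphic sections, it
   is tested where both sides are defined. *)
Definition invariant_form (R : realType) (s n : nat)
    (M : complex_manifold R n) (a : 'rV[Cx R]_s -> M -> M) (D : set M)
    (w : M -> lb_idx (canonical_bundle M) -> Cx R) : Prop :=
  forall t x, torus t -> D x -> D (a t x) ->
    is_form_pullback (a t) x (w (a t x)) (w x).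

(* Main.v *)
(* The torus acts linearly on H^0(M, L).  The orbits of this action are bounded
   and its operators commute, so H^0(M, L) has a basis of weight sections.  By very
   ampleness some n + 1 of them, u_0, ..., u_n, are such that the quotients
   f_l = u_l / u_0 are generically local coordinates.  Each f_l is multiplied by a
   constant under every element of the torus, hence the form
   (df_1 / f_1) /\ ... /\ (df_n / f_n) is invariant.  It equals W / (u_0 ... u_n),
   where the Wronskian W (the determinant of the 1-jets of the u_l) is a holomorphic
   section of K (x) L^(n+1); multiplying both terms by a power of u_0 gives all
   k >= n + 1.

   That W is holomorphic requires derivatives of C^1 holomorphic functions to be
   holomorphic, and that the quotient is meromorphic requires the identity theorem.
   Both follow from the mean value inequality |f(0)| <= max_{|z| = r} |f(z)|, proved
   without integration by averaging over the powers of a root of unity close to 1. *)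

From HB Require Import structures.
Require Import Defs.
From mathcomp Require Import ring.

Set Implicit Arguments.
Unset Strict Implicit.
Unset Printing Implicit Defensive.

Local Open Scope classical_set_scope.
Local Open Scope ring_scope.

(** * Holomorphic functions of one variable *)

(** Everything about W comes from one matrix identity. Arrange the values and first partial
    derivatives of n + 1 functions in a square matrix, one column per function. A map between charts
    and a factor phi between trivialisations enter as block triangular matrices on the left, of
    determinants det J and phi^(n+1); weights scale the columns. The resulting [det_jet_transform]
    is used twice: for the identity map it says that W is a section of K (x) L^(n+1); for a torus
    element it says that W, pulled back, and u_0 ... u_n pick up the same factor phi^(n+1) times the
    product of the weights. The logarithmic form itself is therefore never written down, and the
    quotient is studied directly. The u_l are the columns of a nonzero maximal minor of the jet
    matrix of the whole weight basis, at a point where the immersion property makes its rows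
    independent. Since W involves first derivatives only, a single gain of regularity suffices:
    difference quotients of a derivative converge uniformly. *)

Lemma near_norm_sub (K : numFieldType) (V : normedModType K) (x : V) (e : K) :
  0 < e -> \forall y \near x, `|x - y| < e.
Proof.
by move=> e0; have := nbhsx_ballx x _ e0; rewrite -ball_normE.
Qed.

Lemma continuous_atP (T : topologicalType) (L : numFieldType)
    (W : normedModType L) (f : T -> W) (x : T) :
  {for x, continuous f} <->
  forall e, 0 < e -> \forall y \near x, `|f x - f y| < e.
Proof. exact: cvgrPdist_lt. Qed.

(** This division-free form lives on a full neighbourhood of 0, the point [h = 0] included, so it
    can be pulled back along a continuous map such as the inclusion of the reals in [C] without care
    for an excluded point. *)
Lemma is_deriveP (K : numFieldType) (V W : normedModType K) (f : V -> W)
    (a v : V) (l : W) :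
  is_derive a v f l <->
  forall e : K, 0 < e ->
    \forall h \near (0 : K), `|f (a + h *: v) - f a - h *: l| <= e * `|h|.
Proof.
have E (h : K) : h != 0 ->
    `|l - h^-1 *: ((f \o shift a) (h *: v) - f a)| =
    `|h|^-1 * `|f (a + h *: v) - f a - h *: l|.
  move=> h0; rewrite -normfV -normrZ [in RHS]scalerBr scalerA mulVf// scale1r.
  rewrite -[RHS]normrN opprB /= [h *: v + a]addrC. done.
split=> [[D1 D2] e e0|D].
  have /cvgrPdist_le/(_ e e0) := D1; rewrite -/(derive f a v) D2.
  rewrite /= near_withinE; apply: filterS => h H.
  have [->|h0] := eqVneq h 0.
    by rewrite !scale0r addr0 !subrr !normr0 mulr0.
  by move: (H h0); rewrite E// ler_pdivrMl ?normr_gt0// mulrC.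
suff h : (fun h => h^-1 *: ((f \o shift a) (h *: v) - f a)) @ 0^' --> l.
  by split; [apply/cvg_ex; exists l | apply/cvg_lim].
apply/cvgrPdist_le => e e0.
rewrite /= near_withinE; apply: filterS (D e e0) => h H h0.
by rewrite E// ler_pdivrMl ?normr_gt0// mulrC.
Qed.

Section OneVariable.
Local Open Scope complex_scope.
Variable R : realType.
Local Notation C := (Cx R).
Local Notation toC := (fun x : R => (real_complex R x : C)).

(** The difference quotients along [v] and along [1] coincide, which is how several variables are
    reduced to one: every function is studied on complex lines. *)
Lemma is_derive_line (V W : normedModType C) (f : V -> W) (p v : V) (t : C) (l : W) :
  is_derive (p + t *: v) v f l -> is_derive t 1 (fun s : C => f (p + s *: v)) l.
Proof.
have E : (fun h : C => h^-1 *: (((fun s : C => f (p + s *: v)) \o shift t) (h *: 1) -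
   f (p + t *: v))) =
  (fun h => h^-1 *: ((f \o shift (p + t *: v)) (h *: v) - f (p + t *: v))).
  apply/funext => h /=; rewrite /shift /=; congr (_ *: (f _ - _)).
  by rewrite [h%:A]mulr1 scalerDl addrCA.
by move=> [D1 D2]; split; rewrite /derivable /derive E.
Qed.

Lemma Re_le (x y : C) : x <= y -> complex.Re x <= complex.Re y.
Proof. by move=> h; move: (h : (x : R[i]) <= y); rewrite lecE => /andP[]. Qed.

Lemma Re_norm_le (x y : C) : `|x| <= y -> `|complex.Re x| <= complex.Re y.
Proof.
move=> h; apply: le_trans (Re_le h).
have := normc_ge_Re (x : R[i]).
by move=> /Re_le; apply: le_trans.
Qed.

Lemma real_complex_continuous : continuous (fun t : R => t%:C : C).
Proof.
move=> x; apply/continuous_atP => e e0.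
(* In the partial order of [C] a positive element has zero imaginary part, so [e] may be treated as
   a real number. *)
have eE : e = (complex.Re e)%:C.
  by rewrite RRe_real// ger0_real// ltW.
have e1 : 0 < complex.Re e by rewrite -ltcR -eE.
near=> y.
have : `|x - y| < complex.Re e by near: y; exact: (@near_norm_sub R R x).
rewrite -ltcR -eE; apply: le_lt_trans.
rewrite -rmorphB /=.
by rewrite [X in X <= _]normc_def /= expr0n /= addr0 sqrtr_sqr.
Unshelve. all: by end_near. Qed.

Lemma is_derive_Re (g : C -> C) (t : R) (l : C) :
  is_derive (t%:C : C) 1 g l ->
  is_derive t 1 (fun s : R => complex.Re (g s%:C)) (complex.Re l).
Proof.
move=> /is_deriveP D; apply/is_deriveP => e e0.
have e0' : 0 < (e%:C : C) by rewrite [_ < _]ltcR.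
have D5 : \forall h \near (0 : R), (fun h : C =>
   `|g (t%:C + h *: 1) - g t%:C - h *: l| <= e%:C * `|h|) h%:C.
  have := @real_complex_continuous 0.
  by rewrite /continuous_at => H; exact: (H _ (D _ e0')).
apply: filterS D5 => h /= /Re_norm_le /=.
rewrite expr0n addr0 sqrtr_sqr mul0r subr0.
have -> : t%:C + h%:C%:A = (t + h%:A)%:C :> C.
  by rewrite rmorphD /= ![_%:A]mulr1.
case: (g _) (g _) (l) => [a b] [c d] [u v] /=.
by rewrite mul0r subr0.
Qed.

Lemma is_derive_scale (W : normedModType C) (g : C -> W) (x d : C) (l : W) :
  is_derive x 1 g l -> is_derive x d g (d *: l).
Proof.
move=> [D1 D2]; have D3 := D1; move/derivable1_diffP: D3 => D3.
split; first exact: diff_derivable.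
by rewrite -D2 !deriveE// -linearZ /= [d%:A]mulr1.
Qed.

(* The mean value theorem for the real function [t |-> Re (w^* g(a + t(b-a)))],
   with [w] the total increment. *)
Lemma mean_value_ineq (g dg : C -> C) (a b K : C) :
  (forall t : C, 0 <= t <= 1 ->
     is_derive (a + t * (b - a)) 1 g (dg (a + t * (b - a)))) ->
  (forall t : C, 0 <= t <= 1 -> `|dg (a + t * (b - a))| <= K) ->
  `|g b - g a| <= K * `|b - a|.
Proof.
move=> Dg dgK.
set w := g b - g a.
have [w0|w0] := eqVneq w 0.
  rewrite w0 normr0 mulr_ge0//; apply: le_trans (dgK 0 _) => //.
  by rewrite lexx ler01.
pose psi (t : R) := complex.Re (w^* * g (a + t%:C * (b - a))).
pose dpsi (t : R) := complex.Re (w^* * ((b - a) * dg (a + t%:C * (b - a)))).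
have Dpsi (t : R) : 0 <= t <= 1 -> is_derive t 1 psi (dpsi t).
  move=> t01; apply: (@is_derive_Re (fun s : C => w^* * g (a + s * (b - a)))).
  apply: is_deriveZ.
  apply: (@is_derive_line C C g a (b - a)).
  by apply: is_derive_scale; apply: Dg; rewrite ler0c -[1]/(1%:C) lecR.
have [|||c c01] := @MVT_segment R psi dpsi 0 1.
- by [].
- by move=> x; rewrite in_itv /= => /andP[x0 x1]; apply: Dpsi; rewrite !ltW.
- apply: derivable_within_continuous => x; rewrite in_itv /= => x01.
  by have [] := Dpsi x x01.
rewrite subr0 mulr1 /psi /dpsi mul0r addr0 mul1r subrKC.
set z := w^* * ((b - a) * _) => E.
(* The increment of [psi] over [0, 1] is Re (w^* w) = |w|^2, and the mean value theorem identifies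
   it with Re z; dividing by |w| then gives the claim. *)
have wz : `|w| ^+ 2 <= `|z|.
  rewrite -(RRe_real (_ : `|w| ^+ 2 \is Num.real)); last by rewrite rpredX ?normr_real.
  apply: le_trans (normc_ge_Re (z : R[i])); rewrite lecR.
  apply: le_trans (ler_norm _); rewrite -E sqr_normc.
  rewrite /w; case: (g b) (g a) => [x y] [x' y'] /=.
  by rewrite le_eqVlt; apply/orP; left; apply/eqP; ring.
rewrite -(ler_pM2l (_ : 0 < `|w|)) ?normr_gt0// -expr2 (le_trans wz)//.
rewrite /z !normrM normcJ ler_wpM2l// mulrC ler_wpM2r//.
by apply: dgK; rewrite ler0c -[1]/(1%:C) lecR; rewrite in_itv /= in c01.
Qed.

End OneVariable.

(** * Archimedean bounds, roots of unity and compactness over the complex numbers *)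

Section Bounds.
Local Open Scope complex_scope.
Variable R : realType.
Local Notation C := (Cx R).

Lemma natSinv_lt (e : C) : 0 < e -> exists n : nat, n.+1%:R^-1 < e.
Proof.
move=> e0; have eE : e = (complex.Re e)%:C by rewrite RRe_real// gtr0_real.
have e1 : 0 < complex.Re e by rewrite -ltcR -eE.
exists (Num.truncn (complex.Re e)^-1).
have -> : (Num.truncn (complex.Re e)^-1).+1%:R^-1 =
   ((Num.truncn (complex.Re e)^-1).+1%:R^-1)%:C :> C by rewrite fmorphV rmorph_nat.
rewrite eE ltcR -[X in _ < X]invrK ltf_pV2 ?posrE ?invr_gt0//.
exact: truncnS_gt.
Qed.

(** By Bernoulli's inequality the powers of [y^-1] outgrow [M / x] unless [x] is 0; with d = y^-1 -
    1 the two sides of the induction step differ by m d^2. *)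
Lemma ler_expn_natM (x y M : C) : 0 <= x -> 0 <= y -> 0 <= M -> y < 1 ->
  (forall m, x <= M * y ^+ m) -> x = 0.
Proof.
move=> x0 y0 M0 y1 H.
have [//|xn0] := eqVneq x 0; have xp : 0 < x by rewrite lt_neqAle eq_sym xn0.
case: (eqVneq y 0) => [y00|yn0].
  move: H; rewrite y00 => H; by apply/eqP; rewrite eq_le x0 andbT; have := H 1%N; rewrite expr1 mulr0.
have yp : 0 < y by rewrite lt_neqAle eq_sym yn0.
have Mp : 0 < M.
  by have := H 0%N; rewrite expr0 mulr1; apply: lt_le_trans.
have d0 : 0 < y^-1 - 1 by rewrite subr_gt0 invf_gt1.
have Bern m : 1 + m%:R * (y^-1 - 1) <= y^-1 ^+ m.
  elim: m => [|m IH]; first by rewrite mul0r addr0.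
  have yi : 0 <= y^-1 by rewrite invr_ge0.
  rewrite exprS; apply: le_trans (ler_wpM2l yi IH).
  rewrite -subr_ge0.
  have -> : y^-1 * (1 + m%:R * (y^-1 - 1)) - (1 + m.+1%:R * (y^-1 - 1)) =
    m%:R * (y^-1 - 1) ^+ 2 by rewrite -natr1; ring.
  by rewrite mulr_ge0// exprn_ge0// ltW.
have [|n nlt] := @natSinv_lt (x * (y^-1 - 1) / M).
  by rewrite divr_gt0// mulr_gt0.
have h1 : x * (y^-1) ^+ n.+1 <= M.
  by rewrite exprVn ler_pdivrMr ?exprn_gt0.
have h2 : x * (1 + n.+1%:R * (y^-1 - 1)) <= M.
  by apply: le_trans h1; rewrite ler_pM2l.
suff : M < M by rewrite ltxx.
apply: lt_le_trans h2.
move: nlt; rewrite ltr_pdivlMr// ltr_pdivrMl ?ltr0n// => h3.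
rewrite mulrDr mulr1; apply: lt_trans h3 _.
by rewrite mulrCA ltrDr.
Qed.

(* Repeated square roots of [-1], taking each time the root closer to [1]. *)
Lemma root_of_unity_near1 (d : C) : 0 < d ->
  exists (w : C) (N : nat), [/\ w ^+ N.+1 = 1, w != 1, `|w| = 1 & `|w - 1| < d].
Proof.
move=> d0.
have H m : exists (w : C) (N : nat),
    [/\ w ^+ N.+1 = 1, w != 1, `|w| = 1 & `|w - 1| ^+ 2 <= 4 * 2^-1 ^+ m].
  elim: m => [|m [w [N [wN w1 nw wm]]]].
    exists (-1), 1%N; split.
    - by rewrite sqrrN expr1n.
    - by rewrite -subr_eq0 -opprD oppr_eq0 (_ : 1 + 1 = 2) ?pnatr_eq0//; ring.
    - by rewrite normrN1.
    - by rewrite -opprD normrN expr0 mulr1 ger0_norm ?addr_ge0//;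
      rewrite le_eqVlt; apply/orP; left; apply/eqP; ring.
  have [y [yw yle]] : exists y : C, y ^+ 2 = w /\ `|y - 1| <= `|y + 1|.
    have [h|h] := real_leP (normr_real (sqrtC w - 1)) (normr_real (sqrtC w + 1)).
      by exists (sqrtC w); rewrite sqrtCK.
    exists (- sqrtC w); rewrite sqrrN sqrtCK; split=> //.
    by rewrite -opprD normrN [X in _ <= `|X|]addrC distrC ltW.
  have ny : `|y| = 1.
    apply/eqP; rewrite -(@eqrXn2 _ 2)// -normrX yw nw expr1n//.
  (* The parallelogram law on the unit circle gives |y + 1|^2 >= 2 for the root closer to 1, and
     then (y - 1)(y + 1) = w - 1 shows that |y - 1|^2 is at most half of |w - 1|^2. *)
  have par : `|y - 1| ^+ 2 + `|y + 1| ^+ 2 = 4.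
    rewrite !normCK !(rmorphB, rmorphD) rmorph1 /=.
    have : y * (Num.conj y) = 1 by rewrite -normCK ny expr1n.
    move: (Num.conj y) => z yz; rewrite -[RHS]/(4%:R) -[4%:R](_ : 2 * 1 + 2 = _); last by ring.
    by rewrite -yz; ring.
  exists y, (N.+1 * 2).-1; split => //.
  - by rewrite prednK ?muln_gt0// mulnC exprM yw.
  - by apply: contra_neq w1 => y1; rewrite -yw y1 expr1n.
  have ge2 : 2 <= `|y + 1| ^+ 2.
    have Hh : `|y - 1| ^+ 2 <= `|y + 1| ^+ 2 by rewrite ler_pXn2r ?nnegrE.
    rewrite -(@ler_pM2l _ 2) ?ltr0n//.
    have -> : 2 * 2 = `|y - 1| ^+ 2 + `|y + 1| ^+ 2 by rewrite par; ring.
    by rewrite mulr_natl mulr2n; apply: lerD.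
  have yp : 0 < `|y + 1| ^+ 2 by apply: lt_le_trans ge2; rewrite ltr0n.
  rewrite -(ler_pM2r yp) -exprMn -normrM.
  have -> : (y - 1) * (y + 1) = w - 1 by rewrite -yw; ring.
  apply: le_trans wm _.
  rewrite exprSr -!mulrA ler_pM2l ?ltr0n// ler_peMr ?exprn_ge0 ?invr_ge0 ?ler0n//.
  by rewrite ler_pdivlMl ?ltr0n// mulr1.
have [|n nlt] := @natSinv_lt (d ^+ 2 / 4).
  by rewrite divr_gt0 ?exprn_gt0 ?ltr0n.
have [w [N [wN w1 nw wm]]] := H n.+1.
exists w, N; split=> //.
rewrite -(@ltr_pXn2r _ 2)// ?nnegrE//; last exact: ltW.
apply: le_lt_trans wm _.
move: nlt; rewrite ltr_pdivlMr ?ltr0n// mulrC; apply: le_lt_trans.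
rewrite ler_pM2l ?ltr0n// exprVn lef_pV2 ?posrE ?exprn_gt0 ?ltr0n//.
by rewrite -natrX ler_nat ltnW// ltn_expl.
Qed.

End Bounds.

(** Only [a] has to lie in the compact set. This matters for an annulus: the chord between two
    neighbouring points of a circle may dip below the inner radius. *)
Lemma compact_unif_continuous (K : numFieldType) (V W : normedModType K)
    (A : set V) (g : V -> W) :
  compact A -> (forall x, A x -> {for x, continuous g}) ->
  forall e : K, 0 < e -> exists2 d : K, 0 < d &
    forall a b, A a -> `|b - a| < d -> `|g b - g a| < e.
Proof.
move=> /compact_near_coveringP cA gA e e0.
have := cA V (nbhs (0 : V)) (fun h x => `|g (x + h) - g x| < e) _.
case/(_ _ _)/nbhs_ballP.
  move=> x Ax; have e2 : 0 < e / 2 by rewrite divr_gt0.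
  have /continuous_atP/(_ _ e2) gx := gA x Ax.
  have hx : \forall p \near ((x, 0) : V * V), `|g x - g (p.1 + p.2)| < e / 2.
    have addc := @add_continuous V (x, 0); rewrite /continuous_at /= addr0 in addc.
    exact: (addc _ gx).
  have hx1 : \forall p \near ((x, 0) : V * V), `|g x - g p.1| < e / 2.
    have c1 : p.1 @[p --> ((x, 0) : V * V)] --> x by exact: cvg_fst.
    exact: (c1 _ gx).
  near=> p => /=.
  rewrite -(subrK (g x) (g (p.1 + p.2))) -addrA (splitr e).
  apply: le_lt_trans (ler_normD _ _) _; apply: ltrD.
    by rewrite distrC; near: p.
  by near: p.
move=> d d0 /= dP; exists d => // a b Aa ab.
have := dP (b - a) _ a Aa; rewrite subrKC; apply.
by rewrite -ball_normE /= sub0r normrN.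
Unshelve. all: by end_near. Qed.

(** A local bound on [g] is rephrased as [|g x| * |d| < 1] for all small [d]; compactness in its
    near-covering form then makes one [d] work for all points, and its inverse is the bound. *)
Lemma compact_bounded_fun (K : numFieldType) (V W : normedModType K)
    (A : set V) (g : V -> W) :
  compact A -> (forall x, A x -> {for x, continuous g}) ->
  exists2 B : K, 0 <= B & forall x, A x -> `|g x| <= B.
Proof.
move=> /compact_near_coveringP cA gA.
have := cA K (nbhs (0 : K)) (fun d x => `|g x| * `|d| < 1) _.
case/(_ _ _)/nbhs_ballP.
  move=> x Ax.
  have /continuous_atP/(_ 1 ltr01) gx := gA x Ax.
  have b0 : 0 < (`|g x| + 1)^-1 by rewrite invr_gt0 ltr_wpDl.
  exists ([set y | `|g x - g y| < 1], [set d | `|0 - d| < (`|g x| + 1)^-1]).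
    by split => /=; [exact: gx | exact: (@near_norm_sub K K 0)].
  move=> [y d] /= [h1]; rewrite sub0r normrN => h2.
  have gy : `|g y| < `|g x| + 1.
    rewrite -(subrKC (g x) (g y)) (le_lt_trans (ler_normD _ _))// ltrD2l.
    by rewrite distrC.
  have [->|d0] := eqVneq d 0; first by rewrite normr0 mulr0.
  rewrite -ltr_pdivlMr ?normr_gt0// div1r (lt_trans gy)//.
  by rewrite -[X in X < _]invrK ltf_pV2// posrE ?normr_gt0.
move=> d /= d0 dP; exists ((d / 2)^-1); first by rewrite invr_ge0 ltW ?divr_gt0.
move=> x Ax; have d2 : 0 < d / 2 by rewrite divr_gt0.
have := dP (d / 2) _ x Ax; rewrite /= gtr0_norm// => /(_ _)/ltW.
rewrite -ler_pdivlMr// div1r; apply.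
rewrite -ball_normE /= sub0r normrN gtr0_norm// ltr_pdivrMr// ltr_pMr// ltr1n//.
Qed.

Section CompactDisc.
Local Open Scope complex_scope.
Variable R : realType.
Local Notation C := (Cx R).

Lemma closed_disc (K : numFieldType) (V : normedModType K) (r : K) : r \is Num.real ->
  closed [set z : V | `|z| <= r].
Proof.
move=> r0; rewrite -openC openE => z /= /negP; rewrite -real_ltNge// => rz.
rewrite /interior /=; have d0 : 0 < `|z| - r by rewrite subr_gt0.
apply: filterS (near_norm_sub z d0) => y /= zy yr.
suff : `|z| < `|z| by rewrite ltxx.
rewrite -[z in X in X < _](subrK y) (le_lt_trans (ler_normD _ _))//.
by rewrite -[X in _ < X](subrK r) ltr_leD.
Qed.

(** The disc is closed in the image of the square [[-q, q]^2] under (x, y) |-> x + iy, so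
    compactness is inherited from real segments. *)
Lemma compact_disc (r : C) : compact [set z : C | `|z| <= r].
Proof.
pose f (p : R * R) : C := p.1%:C + 'i * p.2%:C.
have fc : continuous f.
  move=> p; apply: (@continuousD _ C _ (fun p : R * R => p.1%:C : C) (fun p : R * R => 'i * p.2%:C : C)).
    apply: (@continuous_comp _ _ _ fst (fun t : R => t%:C : C)).
      exact: cvg_fst.
    exact: real_complex_continuous.
  apply: (@continuousM C _ (fun=> 'i : C) (fun p : R * R => p.2%:C : C)).
    exact: cst_continuous.
  apply: (@continuous_comp _ _ _ snd (fun t : R => t%:C : C)).
    exact: cvg_snd.
  exact: real_complex_continuous.
have [r0|r0] := boolP (0 <= r); last first.
  rewrite (_ : [set _ | _] = set0); first exact: compact0.
  rewrite -subset0 => z /= zr; move/negP: r0; apply.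
  exact: le_trans (normr_ge0 _) zr.
pose q := complex.Re r.
apply: (@subclosed_compact _ _ (f @` (`[-q, q]%classic `*` `[-q, q]%classic))).
- exact/(@closed_disc C C)/ger0_real.
- apply: continuous_compact; first exact: continuous_subspaceT.
  by apply: compact_setX; exact: segment_compact.
- move=> z /= zr; exists (complex.Re z, complex.Im z) => /=.
    split => /=; rewrite in_itv /= -ler_norml.
      exact: Re_norm_le.
    rewrite -(normrN (complex.Im z)) -ReiNIm; apply: Re_norm_le.
    by rewrite normrM complexiE normCi mulr1.
  rewrite /f /=. by rewrite -complexE.
Qed.
End CompactDisc.

Lemma lt0_min_ex (K : numDomainType) (a b : K) : 0 < a -> 0 < b ->
  exists c : K, [/\ 0 < c, c <= a & c <= b].
Proof.
move=> a0 b0; have [ab|ba] := real_leP (gtr0_real a0) (gtr0_real b0).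
  by exists a.
by exists b; split=> //; exact: ltW.
Qed.

Lemma closed_codisc (K : numFieldType) (V : normedModType K) (r : K) : r \is Num.real ->
  closed [set z : V | r <= `|z|].
Proof.
move=> r0; rewrite -openC openE => z /= /negP; rewrite -real_ltNge// => rz.
rewrite /interior /=; have d0 : 0 < r - `|z| by rewrite subr_gt0.
apply: filterS (near_norm_sub z d0) => y /= zy yr.
suff : r < r by rewrite ltxx.
apply: le_lt_trans yr _.
rewrite -[y in X in X < _](subrK z) (le_lt_trans (ler_normD _ _))//.
by rewrite -[X in _ < X](subrK `|z|) ltr_leD// distrC.
Qed.

(** * The mean value inequality at the centre of a disc and the Cauchy estimate *)

Section CircleMeans.
Variable R : realType.
Local Notation C := (Cx R).

Lemma taylor1_le (H dH : C -> C) (a b e : C) :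
  (forall t : C, 0 <= t <= 1 ->
     is_derive (a + t * (b - a)) 1 H (dH (a + t * (b - a)))) ->
  (forall t : C, 0 <= t <= 1 -> `|dH (a + t * (b - a)) - dH a| <= e) ->
  `|H b - H a - dH a * (b - a)| <= e * `|b - a|.
Proof.
move=> DH dHe.
have := @mean_value_ineq R (fun w => H w - dH a * w) (fun w => dH w - dH a) a b e.
have -> : H b - dH a * b - (H a - dH a * a) = H b - H a - dH a * (b - a) by ring.
apply => // t t01.
apply: is_deriveB; first exact: DH.
have := is_deriveZ (dH a) (is_derive_id (a + t * (b - a)) (1 : C)).
by rewrite /GRing.scale /= mulr1.
Qed.

(* The [s]-derivative of the sum of the [H (s w^k)] is small: up to the factor
   [s (w - 1)] it is a Taylor approximation of the telescoping sum of the
   [H (s w^(k+1)) - H (s w^k)], which vanishes. *)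
Lemma circle_mean_variation (H dH : C -> C) (s0 r e : C) :
  0 < s0 -> s0 <= r -> 0 < e ->
  (forall w : C, 0 < `|w| <= r -> is_derive w 1 H (dH w)) ->
  (forall w : C, 0 < `|w| <= r -> {for w, continuous dH}) ->
  exists (w : C) (N : nat), `|w| = 1 /\
    `|\sum_(k < N.+1) H (r * w ^+ k) - \sum_(k < N.+1) H (s0 * w ^+ k)| <=
    N.+1%:R * e * (r - s0).
Proof.
move=> s00 s0r e0 DH cH.
have r0 : 0 < r by apply: lt_le_trans s0r.
have cK : compact ([set z : C | `|z| <= r] `&` [set z : C | s0 <= `|z|]).
  apply: compact_closedI; first exact: compact_disc.
  exact/(@closed_codisc C C)/gtr0_real.
have [d d0 dP] : exists2 d : C, 0 < d & forall a b, s0 <= `|a| -> `|a| <= r ->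
    `|b - a| < d -> `|dH b - dH a| < e.
  have [|d d0 dP] := @compact_unif_continuous C C C _ dH cK _ e e0.
    move=> x [/= x1 x2]; apply: cH; rewrite x1 andbT; exact: lt_le_trans x2.
  by exists d => // a b a1 a2; apply: dP; split.
have [c [c0 cd cs]] := lt0_min_ex d0 s00.
(* With |w - 1| < c / r, consecutive points [s w^k] and [s w^(k+1)] are closer than [c] for every
   radius s <= r at once. *)
have [|w [N [wN w1 nw wc]]] := @root_of_unity_near1 R (c / r).
  by rewrite divr_gt0.
exists w, N; split=> //.
pose F (s : C) := \sum_(k < N.+1) H (s * w ^+ k).
pose dF (s : C) := \sum_(k < N.+1) w ^+ k * dH (s * w ^+ k).
have nwk k : `|w ^+ k| = 1 by rewrite normrX nw expr1n.
have Fe (s : C) : s0 <= s -> s <= r -> `|dF s| <= N.+1%:R * e.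
  move=> s0s sr.
  have sp : 0 < s by apply: lt_le_trans s0s.
  have w10 : 0 < `|s * (w - 1)| by rewrite normr_gt0 mulf_neq0 ?subr_eq0// gt_eqF.
  have tel : \sum_(k < N.+1) (H (s * w ^+ k.+1) - H (s * w ^+ k)) = 0.
    have := @telescope_sumr _ 0 N.+1 (fun k => H (s * w ^+ k)) (leq0n _).
    by rewrite big_mkord wN expr0 subrr.
  rewrite -(ler_pM2r w10) -normrM mulrC /dF mulr_sumr.
  have -> : \sum_(k < N.+1) s * (w - 1) * (w ^+ k * dH (s * w ^+ k)) =
     - \sum_(k < N.+1) (H (s * w ^+ k.+1) - H (s * w ^+ k)
        - dH (s * w ^+ k) * (s * w ^+ k.+1 - s * w ^+ k)).
    rewrite sumrB tel sub0r opprK; apply: eq_bigr => k _.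
    by rewrite exprS; ring.
  rewrite normrN (le_trans (ler_norm_sum _ _ _))//.
  rewrite -mulrA mulr_natl -[X in _ *+ X](card_ord N.+1) -sumr_const.
  apply: ler_sum => k _.
  have E : `|s * w ^+ k.+1 - s * w ^+ k| = `|s * (w - 1)|.
    rewrite (_ : _ - _ = w ^+ k * (s * (w - 1))); last by rewrite exprS; ring.
    by rewrite normrM nwk mul1r.
  have Ec : `|s * (w - 1)| < c.
    rewrite normrM gtr0_norm// (le_lt_trans (ler_wpM2r _ sr))//.
    by rewrite -ltr_pdivlMl// mulrC.
  have nu t : 0 <= t -> t <= 1 ->
      `|t * (s * w ^+ k.+1 - s * w ^+ k)| <= `|s * (w - 1)|.
    by move=> t0 t1; rewrite normrM E ler_piMl// ger0_norm.
  rewrite -E; refine (@taylor1_le H dH (s * w ^+ k) (s * w ^+ k.+1) e _ _).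
    move=> t /andP[t0 t1]; apply: DH; apply/andP; split.
      (* The chord misses 0: its points are at distance less than c <= s0 <= s from [s w^k], which
         has modulus [s]. *)
      rewrite normr_gt0; apply: contraTneq (le_lt_trans (nu t t0 t1) Ec).
      move=> /eqP; rewrite addrC addr_eq0 => /eqP ->.
      rewrite normrN normrM nwk mulr1 gtr0_norm// -real_leNgt ?gtr0_real//.
      exact: le_trans cs s0s.
    have -> : s * w ^+ k + t * (s * w ^+ k.+1 - s * w ^+ k) =
      (1 - t) * (s * w ^+ k) + t * (s * w ^+ k.+1) by ring.
    apply: le_trans (ler_normD _ _) _; apply: le_trans sr.
    rewrite !normrM !nwk !mulr1 (gtr0_norm sp) !ger0_norm ?subr_ge0//.
    by rewrite -mulrDl subrK mul1r.
  move=> t /andP[t0 t1].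
  apply/ltW/dP.
    by rewrite normrM nwk mulr1 gtr0_norm.
    by rewrite normrM nwk mulr1 gtr0_norm.
  rewrite addrC addKr (lt_le_trans _ cd)// (le_lt_trans _ Ec)//.
  exact: nu.
have rs : 0 <= r - s0 by rewrite subr_ge0.
rewrite -[r - s0]ger0_norm//.
have DF (s : C) : s0 <= s -> s <= r -> is_derive s 1 F (dF s).
  move=> s0s sr.
  have sp : 0 < s by apply: lt_le_trans s0s.
  have -> : F = \sum_(k < N.+1) (fun s : C => H (0 + s * w ^+ k)).
    apply/funext => x; rewrite fct_sumE; apply: eq_bigr => k _.
    by rewrite add0r.
  apply: is_derive_sum => k.
  apply: (@is_derive_line R C C H 0 (w ^+ k)).
  rewrite add0r; apply: is_derive_scale; apply: DH.
  by rewrite normrM nwk mulr1 gtr0_norm// sp.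
refine (@mean_value_ineq R F dF s0 r _ _ _).
- move=> t /andP[t0 t1]; apply: DF.
    by rewrite lerDl mulr_ge0.
  by rewrite -lerBrDl ler_piMl.
- move=> t /andP[t0 t1]; apply: Fe.
    by rewrite lerDl mulr_ge0.
  by rewrite -lerBrDl ler_piMl.
Qed.

End CircleMeans.

Section CauchyEstimate.
Variable R : realType.
Local Notation C := (Cx R).

(** The mean of [H] over the points [s w^k] is close to [H 0] for small [s], at most [M] in modulus
    for s = r, and nearly independent of [s]. At the centre only continuity is assumed, because the
    lemma will be applied to a difference quotient filled in at 0. *)
Lemma circle_center_le (H dH : C -> C) (r M : C) : 0 < r ->
  {for 0, continuous H} ->
  (forall w : C, 0 < `|w| <= r -> is_derive w 1 H (dH w)) ->
  (forall w : C, 0 < `|w| <= r -> {for w, continuous dH}) ->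
  (forall w, `|w| = r -> `|H w| <= M) -> `|H 0| <= M.
Proof.
move=> r0 H0 DH cH HM.
have M0 : 0 <= M by apply: le_trans (HM r (gtr0_norm r0)).
have [//|Mlt] := real_leP (normr_real (H 0)) (ger0_real M0).
(* Chosen so that M + 2 e (1 + r) = |H 0|; the accumulated error e + e (r - s0) is then too small to
   reach |H 0|. *)
pose e := (`|H 0| - M) / (1 + r) / 2.
have r1 : 0 < 1 + r by rewrite addr_gt0.
have e0 : 0 < e by rewrite !divr_gt0// subr_gt0.
have /continuous_atP/(_ e e0)/nbhs_ballP[d /= d0 dP] := H0.
have [c [c0 cd cr]] := lt0_min_ex d0 r0.
pose s0 := c / 2.
have s00 : 0 < s0 by rewrite divr_gt0.
have s0c : s0 < c by rewrite ltr_pdivrMr// ltr_pMr// ltr1n.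
have s0r : s0 <= r by rewrite (le_trans _ cr)// ltW.
have [w [N [nw wN]]] := circle_mean_variation s00 s0r e0 DH cH.
have nwk k : `|w ^+ k| = 1 by rewrite normrX nw expr1n.
have le1 : N.+1%:R * `|H 0| <= N.+1%:R * (M + e + e * (r - s0)).
  have -> : N.+1%:R * `|H 0| = `|\sum_(k < N.+1) H 0|.
    by rewrite sumr_const card_ord -[in RHS]mulr_natl normrM normr_nat.
  have -> : \sum_(k < N.+1) H 0 = \sum_(k < N.+1) (H 0 - H (s0 * w ^+ k)) -
     (\sum_(k < N.+1) H (r * w ^+ k) - \sum_(k < N.+1) H (s0 * w ^+ k)) +
      \sum_(k < N.+1) H (r * w ^+ k).
    by rewrite sumrB; ring.
  have -> : N.+1%:R * (M + e + e * (r - s0)) =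
     N.+1%:R * e + N.+1%:R * e * (r - s0) + N.+1%:R * M by ring.
  apply: le_trans (ler_normD _ _) _; apply: lerD; last first.
    apply: le_trans (ler_norm_sum _ _ _) _.
    rewrite mulr_natl -[X in _ *+ X](card_ord N.+1) -sumr_const.
    by apply: ler_sum => k _; apply: HM; rewrite normrM nwk mulr1 gtr0_norm.
  apply: le_trans (ler_normB _ _) _; apply: lerD => //.
  apply: le_trans (ler_norm_sum _ _ _) _.
  rewrite mulr_natl -[X in _ *+ X](card_ord N.+1) -sumr_const.
  apply: ler_sum => k _; apply/ltW/dP.
  rewrite -ball_normE /= sub0r normrN normrM nwk mulr1 gtr0_norm//.
  exact: lt_le_trans cd.
suff : `|H 0| < `|H 0| by rewrite ltxx.
move: le1; rewrite ler_pM2l ?ltr0n// => /le_lt_trans; apply.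
have : M + 2 * e * (1 + r) = `|H 0| by rewrite /e; field; rewrite gt_eqF.
move=> E; rewrite -[X in _ < X]E -subr_gt0.
have -> : M + 2 * e * (1 + r) - (M + e + e * (r - s0)) = e * (1 + r + s0) by ring.
by rewrite mulr_gt0// addr_gt0.
Qed.

(** The bound at the centre is applied to (f w - f 0) / w, whose value at 0 is the derivative. The
    factor 2 comes from estimating |f w - f 0| by 2 M. *)
Lemma cauchy_estimate (f df : C -> C) (r M : C) : 0 < r ->
  (forall w : C, `|w| <= r -> is_derive w 1 f (df w)) ->
  (forall w : C, `|w| <= r -> {for w, continuous df}) ->
  (forall w : C, `|w| <= r -> `|f w| <= M) -> `|df 0| <= 2 * M / r.
Proof.
move=> r0 Df cf fM.
pose H (w : C) := if w == 0 then df 0 else (f w - f 0) * w^-1.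
pose dH (w : C) := (f w - f 0) * (- w ^- 2) + w^-1 * df w.
have -> : df 0 = H 0 by rewrite /H eqxx.
have fc w : `|w| <= r -> {for w, continuous f}.
  by move=> /Df[/derivable1_diffP/differentiable_continuous].
apply: (@circle_center_le H dH r).
- by [].
- apply/continuous_atP => e e0.
  have /Df/is_deriveP/(_ (e / 2)) : `|0 : C| <= r by rewrite normr0 ltW.
  have e2 : 0 < e / 2 by rewrite divr_gt0.
  move=> /(_ e2); apply: filterS => h.
  rewrite /H eqxx add0r => Hh.
  have [_|h0] := eqVneq h 0; first by rewrite subrr normr0.
  have h0' : 0 < `|h| by rewrite normr_gt0.
  rewrite distrC -(ltr_pM2r h0') -normrM mulrBl divfK// mulrC.
  move: Hh; rewrite [h%:A]mulr1 => /le_lt_trans; apply.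
  by rewrite ltr_pM2r// ltr_pdivrMr// ltr_pMr// ltr1n.
- move=> w /andP[w0 wr]; rewrite normr_gt0 in w0.
  apply: (@near_eq_is_derive C C C (fun w => (f w - f 0) * w^-1)).
    near=> y; rewrite /H ifF//; apply/negbTE.
    have : `|w - y| < `|w| by near: y; apply: (@near_norm_sub C C); rewrite normr_gt0.
    by apply: contraTneq => ->; rewrite subr0 ltxx.
  have D1 : is_derive w 1 (fun w => f w - f 0) (df w).
    rewrite -[df w]subr0; apply: is_deriveB; exact: Df.
  have D2 : is_derive w 1 (fun w => w^-1) (- w ^- 2).
    have Did : derivable (id : C -> C) w 1 by exact: derivable_id.
    split; first exact: (@derivableV C C id w 1 w0 Did).
    have := @deriveV C C id w 1 w0 Did.
    by rewrite derive_id /GRing.scale /= mulr1.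
  exact: (is_deriveM D1 D2).
- move=> w /andP[w0 wr]; rewrite normr_gt0 in w0.
  apply: (@continuousD C C C (fun w => (f w - f 0) * (- w ^- 2)) (fun w => w^-1 * df w)).
    apply: (@continuousM C C (fun w => f w - f 0) (fun w => - w ^- 2)).
      apply: (@continuousB C C C f (fun=> f 0)); [exact: fc|exact: cst_continuous].
    apply: (@continuousN C C C (fun w => w ^- 2)).
    apply: (@continuousV C C (fun w => w ^+ 2)); first by rewrite expf_neq0.
    exact: (@continuousM C C id id w (fun _ => id) (fun _ => id)).
  apply: (@continuousM C C (fun w => w^-1) df); last exact: cf.
  exact: inv_continuous.
- move=> w wr; rewrite /H ifF; last by apply/negbTE; rewrite -normr_gt0 wr.
  rewrite normrM normfV wr ler_pM2r ?invr_gt0//.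
  rewrite mulr_natl mulr2n (le_trans (ler_normB _ _))// lerD// fM ?wr//.
  by rewrite normr0 ltW.
Unshelve. all: by end_near. Qed.

End CauchyEstimate.

Lemma continuous_exprn (K : numFieldType) (T : topologicalType) (f : T -> K) (x : T) k :
  {for x, continuous f} -> {for x, continuous (fun y => f y ^+ k)}.
Proof.
move=> fc; elim: k => [|k IH]; first exact: cst_continuous.
have := continuousM fc IH.
have -> : (fun y => f y ^+ k.+1) = (fun y => f y * f y ^+ k).
  by apply/funext => y; rewrite exprS.
exact.
Qed.

Section UniqueContinuation.
Variable R : realType.
Local Notation C := (Cx R).

(* [G] may be divided by any power of [1 + w], since it vanishes near [-1];
   on the circle [|w| = 3] that power is at least [2 ^ m]. *)
Lemma unique_continuation_line (G dG : C -> C) :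
  (forall w : C, `|w| <= 3 -> is_derive w 1 G (dG w)) ->
  (forall w : C, `|w| <= 3 -> {for w, continuous dG}) ->
  (\forall w \near (-1 : C), G w = 0) -> G 0 = 0.
Proof.
move=> DG cG G0.
have Gc (w : C) : `|w| <= 3 -> {for w, continuous G}.
  by move=> /DG[/derivable1_diffP/differentiable_continuous].
have [|B B0 HB] := @compact_bounded_fun C C C [set z : C | `|z| <= 3] G (@compact_disc R 3).
  exact: Gc.
apply/normr0_eq0.
apply: (@ler_expn_natM R _ 2^-1 B) => //.
- by rewrite invf_lt1// ltr1n.
move=> m.
(* The value of [q] at -1 is irrelevant, as [G] vanishes around that point. The exponent m + 1 fits
   the power rule; the surplus factor, at most 1 on the circle, is dropped at the end. *)
pose q (w : C) := (1 + w)^-1.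
pose H (w : C) := G w * q w ^+ m.+1.
pose dH (w : C) := G w * (m.+1%:R * q w ^+ m * (- q w ^+ 2)) + q w ^+ m.+1 * dG w.
have -> : `|G 0| = `|H 0| by rewrite /H /q addr0 invr1 expr1n mulr1.
have H0 : \forall w \near (-1 : C), G w = 0 /\ dG w = 0.
  have G0' : \forall w \near (-1 : C), \forall y \near w, G y = 0 by apply: nbhs_interior G0.
  near=> w; split; first by near: w.
  have Gw : is_derive w 1 G (dG w).
    apply: DG.
    have : `| -1 - w| < 1 by near: w; apply: (@near_norm_sub C C).
    rewrite -{2}[w](subrK (-1)) => w1; rewrite (le_trans (ler_normD _ _))// normrN1.
    by rewrite -[3]/(3%:R) (natrD _ 2 1) lerD2r distrC ltW// (lt_trans w1)// ltr1n.
  have [_ <-] := Gw.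
  rewrite -[RHS](@derive_cst C C C 0 w 1).
  by apply: (@near_eq_derive C C C G (cst 0)); near: w.
have q_neq (w : C) : w != -1 -> 1 + w != 0 by rewrite addrC addr_eq0.
have Dq (w : C) : w != -1 -> is_derive w 1 q (- q w ^+ 2).
  move=> /q_neq w1.
  have Did : is_derive w 1 (fun w : C => 1 + w) 1.
    rewrite -[X in is_derive _ _ _ X]add0r.
    by apply: is_deriveD.
  have [D1 D2] := Did.
  split; first exact: (@derivableV C C (fun w : C => 1 + w)).
  have := @deriveV C C (fun w : C => 1 + w) w 1 w1 D1.
  by rewrite D2 /GRing.scale /= mulr1 /q exprVn.
have dH0 : \forall w \near (-1 : C), dH w = 0.
  by apply: filterS H0 => y [Gy dGy]; rewrite /dH Gy dGy mul0r mulr0 addr0.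
have DH (w : C) : `|w| <= 3 -> is_derive w 1 H (dH w).
  move=> wr; have [->|wN1] := eqVneq w (-1).
    apply: (@near_eq_is_derive C C C (cst 0)).
      by apply: filterS H0 => y [Gy _]; rewrite /H Gy mul0r.
    by rewrite (nbhs_singleton dH0); apply: is_derive_cst.
  have := is_deriveM (DG w wr) (is_deriveX m.+1 (Dq w wN1)).
  rewrite exprfctE. exact.
refine (@circle_center_le R H dH 3 _ _ _ _ _ _); first by [].
- have [|D1 _] := DH 0; first by rewrite normr0.
  exact/differentiable_continuous/derivable1_diffP.
- by move=> w /andP[_]; exact: DH.
- move=> w /andP[_ wr].
  have [->|wN1] := eqVneq w (-1).
    apply/continuous_atP => e e0; apply: filterS (dH0) => y ->.
    by rewrite (nbhs_singleton dH0) subrr normr0.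
  have qc : {for w, continuous q}.
    by have [/derivable1_diffP/differentiable_continuous] := Dq w wN1.
  apply: (@continuousD C C C (fun w => G w * (m.+1%:R * q w ^+ m * (- q w ^+ 2)))
    (fun w => q w ^+ m.+1 * dG w)).
    apply: (@continuousM C C G (fun w => (m.+1%:R * q w ^+ m * (- q w ^+ 2)))); first exact: Gc.
    apply: (@continuousM C C (fun w => m.+1%:R * q w ^+ m) (fun w => - q w ^+ 2)).
      apply: (@continuousM C C (fun w => m.+1%:R) (fun w => q w ^+ m)).
        exact: cst_continuous.
      exact: continuous_exprn.
    exact: (@continuousN C C C (fun w => q w ^+ 2)) (continuous_exprn qc).
  by apply: (@continuousM C C (fun w => q w ^+ m.+1) dG); [exact: continuous_exprn|exact: cG].
- move=> w wr; rewrite /H normrM ler_pM//; first by apply: HB; rewrite /= wr.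
  have q2 : `|q w| <= 2^-1.
    have w2 : 2 <= `|1 + w|.
      rewrite -(lerD2r `|-1 : C|); apply: le_trans (ler_normD _ _).
      have -> : 1 + w - 1 = w by ring.
      by rewrite wr normrN1 -[3]/(3%:R) (natrD _ 2 1).
    by rewrite normfV lef_pV2 ?posrE ?(lt_le_trans _ w2).
  rewrite normrX exprS -[X in _ <= X]mul1r ler_pM// ?(le_trans q2)//.
    by rewrite invf_le1// ler1n.
  by rewrite lerXn2r ?nnegrE.
Unshelve. all: by end_near. Qed.
End UniqueContinuation.

(** * Holomorphic functions of several variables *)

Section MatrixNorm.
Variables (K : numFieldType) (m n : nat).
Implicit Types A : 'M[K]_(m, n).

Lemma mx_entry_le A i j : `|A i j| <= `|A|.
Proof.
rewrite [leRHS]/Num.Def.normr/= mx_normE.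
rewrite (bigD1 (i, j)) //= num_max.
by rewrite comparable_le_max ?lexx//; apply: real_comparable; apply: ger0_real.
Qed.

Lemma mx_norm_le A (b : K) : 0 <= b -> (forall i j, `|A i j| <= b) -> `|A| <= b.
Proof.
move=> b0 H; rewrite {1}/Num.Def.normr/=.
have [->//|/mx_norm_neq0[[i j] ->]] := eqVneq (mx_norm A) 0; exact: H.
Qed.

Lemma continuous_mx (T : topologicalType) (f : T -> 'M[K]_(m, n)) x :
  (forall i j, {for x, continuous (fun y => f y i j)}) -> {for x, continuous f}.
Proof.
move=> H; apply/continuous_atP => e e0.
have e2 : 0 < e / 2 by rewrite divr_gt0.
have H1 : \forall y \near x, forall i j, `|f x i j - f y i j| < e / 2.
  have := @filter_forall T 'I_m (fun i y => forall j, `|f x i j - f y i j| < e / 2) (nbhs x) _.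
  apply=> i.
  apply: (@filter_forall T 'I_n (fun j y => `|f x i j - f y i j| < e / 2) (nbhs x) _) => j.
  by have /continuous_atP := H i j; apply.
apply: filterS (H1) => y Hy; apply: (@le_lt_trans _ _ (e / 2)).
  apply: mx_norm_le; first exact: ltW.
  by move=> i j; rewrite !mxE ltW.
by rewrite ltr_pdivrMr// ltr_pMr// ltr1n.
Qed.

End MatrixNorm.

Lemma differentiable_of (K : numFieldType) (V W : normedModType K) (f : V -> W)
   (df : {linear V -> W}) x : continuous df ->
  (forall e : K, 0 < e -> \forall h \near (0 : V), `|f (x + h) - f x - df h| <= e * `|h|) ->
  differentiable f x.
Proof.
move=> dfc H.
have E : f \o shift x = cst (f x) + df +o_ 0 id.
  apply/eqaddoP => e e0; apply: filterS (H e e0) => h /=.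
  have -> : (f \o shift x - (cst (f x) + df)) h = f (x + h) - f x - df h.
    by rewrite !fctE /cst /= opprD addrA [h + x]addrC.
  exact.
apply/diff_locallyP; rewrite (diff_unique dfc E); split => //.
Qed.

Lemma continuous_big_sum (K : numFieldType) (V : normedModType K) (T : topologicalType)
    (I : finType) (F : I -> T -> V) x :
  (forall i, {for x, continuous (F i)}) -> {for x, continuous (fun x => \sum_i F i x)}.
Proof.
move=> cF; apply/continuous_atP => e e0.
have /continuous_atP/(_ e e0) : {for x, continuous (\sum_i F i)}.
  by elim/big_rec : _ => [|i f _ IH]; [exact: cst_continuous|apply: continuousD; [exact: cF|]].
by apply: filterS => y; rewrite !fct_sumE.
Qed.

Section PartialDerivatives.
Variables (R : realType) (n : nat).
Local Notation C := (Cx R).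
Implicit Types g : 'rV[C]_n -> C.

(** From [z] to [z + u] one walks along the coordinate directions, and on each edge the mean value
    inequality is applied to [g] minus its linear approximation at [z]. *)
Lemma differentiable_partials g z :
  (\forall y \near z, forall j, derivable g y (delta_mx 0 j)) ->
  (forall j, {for z, continuous (fun y => 'D_(delta_mx 0 j) g y)}) ->
  differentiable g z.
Proof.
move=> Dg cg.
pose L (u : 'rV[C]_n) : C := \sum_j u 0 j * 'D_(delta_mx 0 j) g z.
have linL : linear L.
  move=> a u v; rewrite /L scaler_sumr -big_split /=; apply: eq_bigr => j _.
  by rewrite !mxE mulrDl -mulrA.
pose LM := GRing.isLinear.Build _ _ _ _ L linL.
pose LL : {linear 'rV[C]_n -> C} := HB.pack L LM.
apply: (@differentiable_of _ _ _ _ LL).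
  have -> : (LL : 'rV[C]_n -> C) = fun u => \sum_j u 0 j * 'D_(delta_mx 0 j) g z by [].
  move=> u; apply: continuous_big_sum => j.
  apply: (@continuousM C _ (fun u : 'rV[C]_n => u 0 j)).
    exact: coord_continuous.
  exact: cst_continuous.
move=> e e0.
(* Each of the n edges may cost this much; dividing by n + 1 instead of n also covers dimension
   0. *)
have e1 : 0 < e / n.+1%:R by rewrite divr_gt0.
have H : \forall y \near z, (forall j, derivable g y (delta_mx 0 j)) /\
   forall j, `|'D_(delta_mx 0 j) g z - 'D_(delta_mx 0 j) g y| < e / n.+1%:R.
  near=> y; split; first by near: y.
  near: y.
  apply: (@filter_forall _ _ (fun j y =>
    `|'D_(delta_mx 0 j) g z - 'D_(delta_mx 0 j) g y| < e / n.+1%:R)) => j.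
  by have /continuous_atP := cg j; apply.
have /nbhs_ballP[d /= d0 dP] := H.
near=> u.
have ud : `|u| < d.
  have : `|0 - u| < d by near: u; apply: (@near_norm_sub C 'rV[C]_n 0).
  by rewrite sub0r normrN.
rewrite /L.
(* The vertices of the path: the first k coordinates of [u] are already in place. *)
pose P (k : nat) : 'rV[C]_n := \row_j (if (j < k)%N then u 0 j else 0).
have P0 : P 0%N = 0 by apply/rowP => j; rewrite !mxE.
have Pn : P n = u by apply/rowP => j; rewrite !mxE ltn_ord.
have PS (k : 'I_n) : P k.+1 = P k + u 0 k *: delta_mx 0 k.
  apply/rowP => j; rewrite !mxE eqxx /= ltnS leq_eqVlt.
  have [->|jk] := eqVneq j k; first by rewrite eqxx ltnn mulr1 add0r.
  by rewrite -val_eqE /= in jk; rewrite (negbTE jk) mulr0 addr0.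
have step (k : 'I_n) : `|g (z + P k.+1) - g (z + P k) - u 0 k * 'D_(delta_mx 0 k) g z|
    <= e / n.+1%:R * `|u|.
  pose G (t : C) := g (z + P k + t *: delta_mx 0 k) - 'D_(delta_mx 0 k) g z * t.
  pose dG (t : C) := 'D_(delta_mx 0 k) g (z + P k + t *: delta_mx 0 k) - 'D_(delta_mx 0 k) g z.
  have near_pt (t : C) : 0 <= t <= 1 ->
     `|z - (z + P k + (0 + t * (u 0 k - 0)) *: delta_mx 0 k)| < d.
    move=> /andP[t0 t1]; apply: le_lt_trans ud.
    rewrite -addrA opprD addrA subrr sub0r normrN add0r subr0.
    apply: mx_norm_le => // i j; rewrite !mxE (ord1 i) eqxx /=.
    have [->|jk] := eqVneq j k.
      rewrite ltnn add0r mulr1 normrM; apply: le_trans (mx_entry_le u 0 k).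
      by rewrite ler_piMl// ger0_norm.
    rewrite mulr0 addr0; case: ifP => _; first exact: mx_entry_le.
    by rewrite normr0.
  have in_d (t : C) : 0 <= t <= 1 ->
     ball z d (z + P k + (0 + t * (u 0 k - 0)) *: delta_mx 0 k).
    by move=> t01; rewrite -ball_normE /=; exact: near_pt.
  have := @mean_value_ineq R G dG 0 (u 0 k) (e / n.+1%:R).
  have -> : G (u 0 k) - G 0 =
      g (z + P k.+1) - g (z + P k) - u 0 k * 'D_(delta_mx 0 k) g z.
    by rewrite /G PS addrA scale0r addr0; ring.
  move=> M; apply: le_trans (M _ _) _.
  - move=> t t01; have [Dgt _] := dP _ (in_d t t01).
    apply: is_deriveB.
      apply: (@is_derive_line R _ _ g (z + P k) (delta_mx 0 k)).
      exact: derivableP.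
    have := is_deriveZ ('D_(delta_mx 0 k) g z) (is_derive_id (0 + t * (u 0 k - 0)) (1 : C)).
    by rewrite /GRing.scale /= mulr1.
  - move=> t t01; rewrite /dG distrC; apply/ltW.
    by have [_] := dP _ (in_d t t01); apply.
  - by rewrite subr0 ler_wpM2l ?mx_entry_le// ltW.
have -> : g (z + u) - g z - \sum_j u 0 j * 'D_(delta_mx 0 j) g z =
   \sum_(k < n) (g (z + P k.+1) - g (z + P k) - u 0 k * 'D_(delta_mx 0 k) g z).
  rewrite sumrB; congr (_ - _).
  have := @telescope_sumr _ 0 n (fun k => g (z + P k)) (leq0n _).
  by rewrite big_mkord Pn P0 addr0.
apply: le_trans (ler_norm_sum _ _ _) _.
apply: (@le_trans _ _ (\sum_(k < n) e / n.+1%:R * `|u|)).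
  by apply: ler_sum => k _; exact: step.
rewrite sumr_const card_ord -mulrnAl ler_wpM2r// -mulrnAr ler_piMr ?(ltW e0)//.
by rewrite -[_ *+ n]mulr_natl ler_pdivrMr// mul1r ler_nat.
Unshelve. all: by end_near. Qed.

End PartialDerivatives.

Definition C1_at (K : numFieldType) (V W : normedModType K) (f : V -> W) (z : V) :=
  differentiable f z /\ forall v, {for z, continuous (fun y => 'D_v f y)}.

Lemma norm_le_addr (K : numDomainType) (V : normedZmodType K) (a b : V) (c : K) :
  `|a - b| <= c -> `|a| <= `|b| + c.
Proof.
move=> H; have -> : a = b + (a - b) by rewrite subrKC.
by apply: le_trans (ler_normD _ _) _; rewrite lerD2l.
Qed.

Lemma half_lt (K : numFieldType) (d : K) : 0 < d -> d / 2 < d.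
Proof. by move=> d0; rewrite ltr_pdivrMr// ltr_pMr// ltr1n. Qed.

Lemma norm_half_lt (K : numFieldType) (d : K) : 0 < d -> 0 < `|d / 2| < d.
Proof.
move=> d0; have d2 : 0 < d / 2 by rewrite divr_gt0.
rewrite gtr0_norm// d2 /=.
by rewrite ltr_pdivrMr// ltr_pMr// ltr1n.
Qed.

(** * Derivatives of holomorphic functions are again of class C^1 *)

Section Regularity.
Variables (R : realType) (n : nat).
Local Notation C := (Cx R).
Local Notation V := ('rV[C]_n).

Lemma continuous_line (V' : normedModType C) (p w : V') : continuous (fun t : C => p + t *: w).
Proof.
move=> t; apply: (@continuousD C V' C (fun=> p) (fun s : C => s *: w)); first exact: cst_continuous.
exact: scalel_continuous.
Qed.

Lemma C1_line (V' W : normedModType C) (f : V' -> W) p w (t : C) : C1_at f (p + t *: w) ->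
  is_derive t 1 (fun s : C => f (p + s *: w)) ('D_w f (p + t *: w)) /\
  {for t, continuous (fun s : C => 'D_w f (p + s *: w))}.
Proof.
move=> [Df cf]; split.
  by apply: is_derive_line; apply: derivableP; apply: diff_derivable.
apply: (@continuous_comp _ _ _ (fun s : C => p + s *: w) (fun y => 'D_w f y)).
  exact: continuous_line.
exact: cf.
Qed.

Lemma compact_polydisc (z : V) (r : C) : 0 <= r -> compact [set y : V | `|y - z| <= r].
Proof.
move=> r0.
have -> : [set y : V | `|y - z| <= r] =
  [set y : V | forall i, [set w : C | `|w - z 0 i| <= r] (y ord0 i)].
  apply/seteqP; split=> y /= H.
    by move=> i; apply: le_trans H; have := mx_entry_le (y - z) 0 i; rewrite !mxE.
  by apply: mx_norm_le => // i j; rewrite (ord1 i) !mxE.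
apply: (@rV_compact C n (fun i => [set w : C | `|w - z 0 i| <= r])) => i.
have -> : [set w : C | `|w - z 0 i| <= r] = (fun t => z 0 i + t) @` [set t : C | `|t| <= r].
  apply/seteqP; split=> w /=.
    by move=> H; exists (w - z 0 i) => //; rewrite subrKC.
  by move=> [t tr <-]; rewrite addrC addKr.
apply: continuous_compact; last exact: compact_disc.
apply: continuous_subspaceT => t.
apply: (@continuousD C C C (fun=> z 0 i) id); [exact: cst_continuous|exact: cvg_id].
Qed.

Variables (f : V -> C) (z : V) (rho : C) (v w : V).
Hypothesis rho0 : 0 < rho.
Hypothesis fC1 : forall y, `|y - z| <= 3 * rho -> C1_at f y.

Let p (h : C) (y : V) := h^-1 * ('D_w f (y + h *: v) - 'D_w f y).

(* The difference quotients of [f] along [v] converge uniformly to ['D_v f], so by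
   the Cauchy estimate their derivatives along [w] form a uniform Cauchy family. *)
Lemma quotient_cauchy (e : C) : 0 < e -> exists2 d : C, 0 < d &
  forall h k y, 0 < `|h| < d -> 0 < `|k| < d -> `|y - z| <= rho ->
  `|p h y - p k y| <= e.
Proof.
move=> e0.
have w1 : 0 < `|w| + 1 by rewrite ltr_wpDl.
have v1 : 0 < `|v| + 1 by rewrite ltr_wpDl.
(* Starting within [rho] of [z], a step [t w] with |t| <= r0 and a step [h v] each add at most
   [rho], so everything stays within 3 rho. With a bound 2 e1 on the circle, the Cauchy estimate
   yields 2 (2 e1) / r0 = e. *)
pose r0 := rho / (`|w| + 1).
have r00 : 0 < r0 by rewrite divr_gt0.
pose e1 := e * r0 / 4.
have e10 : 0 < e1 by rewrite divr_gt0 ?mulr_gt0// ltr0n.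
have cK : compact [set y : V | `|y - z| <= 2 * rho].
  by apply: compact_polydisc; rewrite mulr_ge0// ltW.
have le23 : 2 * rho <= 3 * rho by rewrite ler_wpM2r ?ler_nat// ltW.
have E3 : 2 * rho + rho = 3 * rho by ring.
have E2 : rho + rho = 2 * rho by ring.
have [|d d0 dP] := @compact_unif_continuous _ _ _ _ (fun y => 'D_v f y) cK _ e1 e10.
  by move=> y /= yz; have [_ H] := fC1 (le_trans yz le23); exact: H.
have [c [c0 cd cr]] := lt0_min_ex d0 rho0.
have near_v t a : `|t| <= c / (`|v| + 1) -> `|a - z| <= 2 * rho ->
    `|a + t *: v - z| <= 3 * rho /\ `|(a + t *: v) - a| < d.
  move=> tc ar.
  have tv : `|t *: v| < c.
    rewrite normrZ; apply: le_lt_trans (ler_wpM2r (normr_ge0 _) tc) _.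
    by rewrite -mulrA gtr_pMr// mulrC ltr_pdivrMr// mul1r ltrDl.
  split; last by rewrite addrC addKr (lt_le_trans tv).
  by rewrite addrAC -E3 (le_trans (ler_normD _ _))// lerD// (le_trans (ltW tv)).
exists (c / (`|v| + 1)); first by rewrite divr_gt0.
move=> h k y hd kd yz.
pose q (h : C) (y : V) := h^-1 * (f (y + h *: v) - f y).
(* Mean value inequality for [f] minus its tangent along [v]; the uniform continuity of ['D_v f]
   makes the bound independent of [a]. *)
have qD h' a : 0 < `|h'| < c / (`|v| + 1) -> `|a - z| <= 2 * rho ->
    `|q h' a - 'D_v f a| <= e1.
  move=> /andP[h0 hd'] az.
  pose G (t : C) := f (a + t *: v) - 'D_v f a * t.
  pose dG (t : C) := 'D_v f (a + t *: v) - 'D_v f a.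
  have near_t (t : C) : 0 <= t <= 1 -> `|0 + t * (h' - 0)| <= c / (`|v| + 1).
    move=> /andP[t0 t1]; rewrite add0r subr0 normrM.
    apply: le_trans (ltW hd'); by rewrite ler_piMl// ger0_norm.
  have := @mean_value_ineq R G dG 0 h' e1.
  have -> : G h' - G 0 = h' * (q h' a - 'D_v f a).
    rewrite /G /q scale0r addr0 mulrBr mulrA divff -?normr_gt0//; ring.
  rewrite subr0 normrM mulrC ler_pM2r//; apply.
    move=> t t01; apply: is_deriveB.
      apply: (C1_line _).1; apply: fC1.
      by have [] := near_v _ a (near_t t t01) az; rewrite subr0.
    have := is_deriveZ ('D_v f a) (is_derive_id (0 + t * h') (1 : C)).
    by rewrite /GRing.scale /= mulr1.
  move=> t t01; apply/ltW/dP => //.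
  by have [_] := near_v _ a (near_t t t01) az; rewrite subr0.
pose F (t : C) := q h (y + t *: w) - q k (y + t *: w).
pose dF (t : C) := p h (y + t *: w) - p k (y + t *: w).
have inK (t : C) : `|t| <= r0 -> `|y + t *: w - z| <= 2 * rho.
  move=> tr; rewrite addrAC -E2 (le_trans (ler_normD _ _))// lerD//.
  rewrite normrZ (le_trans (ler_wpM2r _ tr))//.
  by rewrite /r0 -mulrA ger_pMr// mulrC ler_pdivrMr// mul1r lerDl.
have line (h' t : C) : 0 < `|h'| < c / (`|v| + 1) -> `|t| <= r0 ->
   is_derive t 1 (fun t : C => q h' (y + t *: w)) (p h' (y + t *: w)) /\
   {for t, continuous (fun t : C => p h' (y + t *: w))}.
  move=> /andP[h0 hd'] tr.
  have A1 : C1_at f (y + t *: w) by apply: fC1; exact: le_trans (inK t tr) le23.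
  have A2 : C1_at f (y + h' *: v + t *: w).
    apply: fC1; rewrite [y + _ + _]addrAC.
    by have [] := near_v h' _ (ltW hd') (inK t tr).
  have [D1 D1'] := C1_line A1; have [D2 D2'] := C1_line A2.
  have comm (s : C) : y + s *: w + h' *: v = y + h' *: v + s *: w by rewrite addrAC.
  have q_eq : (fun t : C => q h' (y + t *: w)) =
      (h'^-1 \*: ((fun t : C => f (y + h' *: v + t *: w)) - (fun t : C => f (y + t *: w)))).
    by apply/funext => s; rewrite /q comm.
  have p_eq : (fun t : C => p h' (y + t *: w)) =
      (h'^-1 \*: ((fun t : C => 'D_w f (y + h' *: v + t *: w)) - (fun t : C => 'D_w f (y + t *: w)))).
    by apply/funext => s; rewrite /p comm.
  split.
    have := is_deriveZ h'^-1 (is_deriveB D2 D1).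
    by rewrite q_eq /p comm; exact.
  rewrite p_eq.
  have Dc := @continuousB C C C _ _ t D2' D1'.
  exact: (@continuousM C C (fun=> h'^-1) _ t (@cst_continuous _ _ _ t) Dc).
have := @cauchy_estimate R F dF r0 (2 * e1) r00.
rewrite /dF scale0r addr0.
have -> : 2 * (2 * e1) / r0 = e by rewrite /e1; field; rewrite gt_eqF.
apply.
- by move=> t tr; apply: is_deriveB; apply: (line _ _ _ _).1.
- move=> t tr; apply: continuousB; exact: (line _ _ _ _).2.
- move=> t tr; rewrite /F -(subrKA ('D_v f (y + t *: w))) mulr_natl mulr2n.
  rewrite (le_trans (ler_normD _ _))// lerD//; first by apply: qD => //; exact: inK.
  by rewrite distrC; apply: qD => //; exact: inK.
Qed.

(** The quotients at [y] form a Cauchy family confined to a disc, hence converge by compactness of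
    the disc. Letting [k] tend to 0 in [quotient_cauchy] gives the rate, uniformly in [y]. *)
Lemma quotient_near (e : C) : 0 < e -> exists2 d : C, 0 < d &
  forall h y, 0 < `|h| < d -> `|y - z| <= rho ->
  derivable (fun y => 'D_w f y) y v /\ `|p h y - 'D_v (fun y => 'D_w f y) y| <= e.
Proof.
move=> e0; have e2 : 0 < e / 2 by rewrite divr_gt0.
have [d d0 dP] := quotient_cauchy e2; exists d => // h y hd yz.
have near_d (r : C) : 0 < r -> \forall k \near (0 : C)^', 0 < `|k| < r.
  move=> r0; near=> k; apply/andP; split.
    by rewrite normr_gt0; near: k; exact: nbhs_dnbhs_neq.
  by near: k; exact: dnbhs0_lt.
have derE : (fun h : C => h^-1 *: (((fun y => 'D_w f y) \o shift y) (h *: v) - 'D_w f y)) =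
    (fun h => p h y).
  by apply/funext => k; rewrite /p /= [k *: v + y]addrC.
have Dy : derivable (fun y => 'D_w f y) y v.
  rewrite /derivable derE.
  have [d1 d10 d1P] := quotient_cauchy ltr01.
  have d12 : 0 < `|d1 / 2| < d1.
    exact: norm_half_lt.
  apply: (@compact_cauchy_cvg C [set t : C | `|t| <= `|p (d1 / 2) y| + 1]).
  - apply: cauchy_exP => r r0.
    have r2 : 0 < r / 2 by rewrite divr_gt0.
    have [d2 d20 d2P] := quotient_cauchy r2.
    have d22 : 0 < `|d2 / 2| < d2.
      exact: norm_half_lt.
    exists (p (d2 / 2) y).
    have := near_d _ d20; apply: filterS => k kd; rewrite -ball_normE /=.
    apply: le_lt_trans (d2P _ _ _ d22 kd yz) _.
    exact: half_lt.
  - have := near_d _ d10; apply: filterS => k kd.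
    by apply: norm_le_addr; exact: d1P.
  - exact: compact_disc.
split; first exact: Dy.
have /cvgrPdist_lt/(_ _ e2) H : (fun h => p h y) @ 0^' --> 'D_v (fun y => 'D_w f y) y.
  by rewrite -derE; exact: Dy.
have [k [k1 k2]] : exists k, 0 < `|k| < d /\ `|'D_v (fun y => 'D_w f y) y - p k y| < e / 2.
  have [k [k1 k2]] := filter_ex (filterI (near_d _ d0) H).
  by exists k; split; [exact: k1|exact: k2].
apply: le_trans (ler_distD (p k y) _ _) _; rewrite [leRHS]splitr; apply: lerD.
  exact: dP.
by rewrite distrC; apply: ltW.
Unshelve. all: by end_near. Qed.

(** A uniform limit of continuous functions: a single quotient [p h] is compared with the second
    derivative at [z] and at [y]. *)
Lemma second_derivative_continuous : {for z, continuous (fun y => 'D_v (fun y => 'D_w f y) y)}.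
Proof.
apply/continuous_atP => e e0.
have e3 : 0 < e / 4 by rewrite divr_gt0// ltr0n.
have [d d0 dP] := quotient_near e3.
have v1 : 0 < `|v| + 1 by rewrite ltr_wpDl.
have rv : 0 < rho / (`|v| + 1) by rewrite divr_gt0.
have [c [c0 cd cr]] := lt0_min_ex d0 rv.
pose h := c / 2.
have hc : h < c by exact: half_lt.
have hd : 0 < `|h| < d.
  by rewrite gtr0_norm ?divr_gt0//= (lt_le_trans hc).
have rho3 : rho <= 3 * rho by rewrite ler_peMl ?ler1n// ltW.
have zh : C1_at f (z + h *: v).
  apply: fC1; rewrite addrAC subrr add0r normrZ gtr0_norm ?divr_gt0//.
  apply: le_trans rho3; rewrite (le_trans (ler_wpM2r _ (le_trans (ltW hc) cr)))//.
  by rewrite -mulrA ger_pMr// mulrC ler_pdivrMr// mul1r lerDl.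
have zC : C1_at f z by apply: fC1; rewrite subrr normr0 mulr_ge0// ltW.
have pc : {for z, continuous (p h)}.
  apply: (@continuousM C V (fun=> h^-1) (fun y => 'D_w f (y + h *: v) - 'D_w f y)).
    exact: cst_continuous.
  apply: (@continuousB C C V (fun y => 'D_w f (y + h *: v)) (fun y => 'D_w f y)).
    apply: (@continuous_comp _ _ _ (fun y : V => y + h *: v) (fun y => 'D_w f y)).
      by apply: (@continuousD C V V id (fun=> h *: v)); [exact: cvg_id|exact: cst_continuous].
    by have [_] := zh; exact.
  by have [_] := zC; exact.
have /continuous_atP/(_ _ e3) pc' := pc.
near=> y.
have yz : `|y - z| <= rho.
  by rewrite distrC ltW//; near: y; exact: (@near_norm_sub C V).
have zz : `|z - z| <= rho by rewrite subrr normr0 ltW.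
have [_ H1] := dP h z hd zz.
have [_ H2] := dP h y hd yz.
have H3 : `|p h z - p h y| < e / 4 by near: y.
have e4 : e / 4 + (e / 4 + e / 4) < e.
  have -> : e / 4 + (e / 4 + e / 4) = e - e / 4 by field.
  by rewrite ltrBlDr ltrDl.
apply: le_lt_trans e4; apply: le_trans (ler_distD (p h z) _ _) _; apply: lerD.
  by rewrite distrC; exact: H1.
apply: le_trans (ler_distD (p h y) _ _) _; apply: lerD; [exact: ltW|exact: H2].
Unshelve. all: by end_near. Qed.

End Regularity.

(** The germ version of [holomorphic_on]. Requiring the conditions on a neighbourhood makes the
    usual derivative formulas valid near the point, which is what continuity of the derivatives of
    sums, products and composites rests on. *)
Definition holo_at (K : numFieldType) (V W : normedModType K) (f : V -> W) (z : V) :=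
  \forall y \near z, C1_at f y.

Lemma near_continuous (T U : topologicalType) (f : T -> U) x (P : U -> Prop) :
  {for x, continuous f} -> (\forall y \near f x, P y) -> \forall y \near x, P (f y).
Proof. by move=> fc H; exact: (fc _ H). Qed.

Section HoloGeneral.
Variables (K : numFieldType) (V W : normedModType K).
Implicit Types f g : V -> W.

Lemma holo_at_C1 f z : holo_at f z -> C1_at f z.
Proof. exact: nbhs_singleton. Qed.

Lemma holo_at_near f z : holo_at f z -> \forall y \near z, holo_at f y.
Proof. exact: nbhs_interior. Qed.

Lemma holo_at_diff f z : holo_at f z -> differentiable f z.
Proof. by move=> /holo_at_C1[]. Qed.

Lemma holo_at_continuous f z : holo_at f z -> {for z, continuous f}.
Proof. by move=> /holo_at_diff/differentiable_continuous. Qed.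

Lemma diff_estimate f z : differentiable f z ->
  forall e : K, 0 < e -> \forall h \near (0 : V), `|f (z + h) - f z - 'd f z h| <= e * `|h|.
Proof.
move=> Df e e0; have /eqaddoP/(_ e e0) := diff_locally Df.
apply: filterS => h.
have -> : (f \o shift z - (cst (f z) + 'd f z)) h = f (z + h) - f z - 'd f z h.
  by rewrite !fctE /cst /= opprD addrA [h + z]addrC.
exact.
Qed.

Lemma near_eq_differentiable f g z :
  (\forall y \near z, f y = g y) -> differentiable f z -> differentiable g z.
Proof.
move=> fg Df; apply: (@differentiable_of _ _ _ _ ('d f z)).
  exact: diff_continuous.
move=> e e0.
have fgz : \forall h \near (0 : V), f (z + h) = g (z + h).
  have c0 : (z + h) @[h --> (0 : V)] --> z.
    by rewrite -[X in _ --> X]addr0; apply: cvgD; [exact: cvg_cst|exact: cvg_id].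
  exact: (c0 _ fg).
near=> h.
rewrite -(near fgz h)// -(nbhs_singleton fg).
by near: h; exact: diff_estimate.
Unshelve. all: by end_near. Qed.

Lemma near_eq_C1 f g z : (\forall y \near z, f y = g y) -> C1_at f z -> C1_at g z.
Proof.
move=> fg [Df cf]; split; first exact: near_eq_differentiable Df.
move=> v; have /continuous_atP H := cf v; apply/continuous_atP => e e0.
have E : \forall y \near z, 'D_v f y = 'D_v g y.
  have := nbhs_interior fg; apply: filterS => y Hy.
  exact: near_eq_derive.
near=> y.
by rewrite -(nbhs_singleton E) -(near E y)//; near: y; exact: H.
Unshelve. all: by end_near. Qed.

Lemma near_eq_holo f g z : (\forall y \near z, f y = g y) -> holo_at f z -> holo_at g z.
Proof.
move=> /nbhs_interior fg /(filterI fg); apply: filterS => y [fgy].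
exact: near_eq_C1.
Qed.

Lemma holo_at_intro (P : V -> Prop) f z :
  (\forall y \near z, P y) -> (forall y, P y -> C1_at f y) -> holo_at f z.
Proof. by move=> Pz H; apply: filterS Pz. Qed.

Lemma holo_cst (a : W) (z : V) : holo_at (fun=> a) z.
Proof.
apply: (@holo_at_intro (fun=> True) (fun=> a)); first exact: filterT.
move=> y _; split; first exact: differentiable_cst.
move=> v; apply/continuous_atP => e e0; apply: nearW => x.
by rewrite !derive_cst subrr normr0.
Qed.

Lemma holo_add f g z : holo_at f z -> holo_at g z -> holo_at (fun y => f y + g y) z.
Proof.
move=> /holo_at_near fz /holo_at_near gz.
apply: holo_at_intro (filterI fz gz) _ => {fz gz} y [fy gy].
have [Df cf] := holo_at_C1 fy; have [Dg cg] := holo_at_C1 gy.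
split; first exact: differentiableD.
move=> v; have /continuous_atP H := @continuousD K W V _ _ y (cf v) (cg v).
apply/continuous_atP => e e0.
have E : \forall x \near y, 'D_v (fun y => f y + g y) x = 'D_v f x + 'D_v g x.
  apply: (filterS _ (filterI fy gy)) => x [[Dfx _] [Dgx _]].
  by rewrite deriveD//; exact: diff_derivable.
near=> x.
by rewrite (nbhs_singleton E) (near E x)//; near: x; exact: H.
Unshelve. all: by end_near. Qed.

End HoloGeneral.

Lemma holomorphic_onP (R : realType) (V W : normedModType (Cx R)) (f : V -> W) (U : set V) : open U ->
  holomorphic_on U f <-> (forall z, U z -> holo_at f z).
Proof.
move=> oU; split=> [[Df cf] z Uz|H].
  have : nbhs z U by apply: open_nbhs_nbhs.
  by apply: filterS => y Uy; split=> [|v]; [exact: Df|exact: cf].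
split=> [z Uz|v z Uz].
  exact: holo_at_diff (H z Uz).
by have [_] := holo_at_C1 (H z Uz); exact.
Qed.

Section HoloScalar.
Variables (K : numFieldType) (V : normedModType K).
Implicit Types f g : V -> K.

Lemma holo_mul f g z : holo_at f z -> holo_at g z -> holo_at (fun y => f y * g y) z.
Proof.
move=> /holo_at_near fz /holo_at_near gz.
apply: holo_at_intro (filterI fz gz) _ => {fz gz} y [fy gy].
have [Df cf] := holo_at_C1 fy; have [Dg cg] := holo_at_C1 gy.
split; first exact: differentiableM.
move=> v.
have H1 := @continuousM K V _ _ y (holo_at_continuous fy) (cg v).
have H2 := @continuousM K V _ _ y (holo_at_continuous gy) (cf v).
have /continuous_atP H := @continuousD K K V _ _ y H1 H2.
apply/continuous_atP => e e0.
have E : \forall x \near y, 'D_v (fun y => f y * g y) x = f x * 'D_v g x + g x * 'D_v f x.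
  apply: (filterS _ (filterI fy gy)) => x [[Dfx _] [Dgx _]].
  by rewrite deriveM//; exact: diff_derivable.
near=> x.
by rewrite (nbhs_singleton E) (near E x)//; near: x; exact: H.
Unshelve. all: by end_near. Qed.

Lemma holo_inv f z : f z != 0 -> holo_at f z -> holo_at (fun y => (f y)^-1) z.
Proof.
move=> fz0 fz.
have near0 y : f y != 0 -> holo_at f y -> \forall x \near y, f x != 0.
  move=> fy0 /holo_at_continuous/continuous_atP/(_ `|f y|).
  rewrite normr_gt0 => /(_ fy0); apply: filterS => x.
  by apply: contraTneq => ->; rewrite subr0 ltxx.
apply: holo_at_intro (filterI (near0 z fz0 fz) (holo_at_near fz)) _ => y [fy0 fy].
have [Df cf] := holo_at_C1 fy.
split; first exact: differentiableV.
move=> v.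
have H1 : {for y, continuous (fun x => - (f x) ^- 2)}.
  apply: (@continuousN K K V (fun x => (f x) ^- 2)).
  apply: (@continuousV K V (fun x => f x ^+ 2)); first by rewrite expf_neq0.
  exact: continuous_exprn (holo_at_continuous fy).
have /continuous_atP H := @continuousM K V _ _ y H1 (cf v).
apply/continuous_atP => e e0.
have E : \forall x \near y, 'D_v (fun y => (f y)^-1) x = - (f x) ^- 2 * 'D_v f x.
  apply: (filterS _ (filterI (near0 y fy0 fy) fy)) => x [fx0 [Dfx _]].
  by rewrite deriveV//; exact: diff_derivable.
near=> x.
by rewrite (nbhs_singleton E) (near E x)//; near: x; exact: H.
Unshelve. all: by end_near. Qed.

Lemma holo_sum (I : Type) (r : seq I) (P : pred I) (F : I -> V -> K) z :
  (forall i, holo_at (F i) z) -> holo_at (fun y => \sum_(i <- r | P i) F i y) z.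
Proof.
move=> HF; elim: r => [|i r IH].
  by apply: near_eq_holo (@holo_cst K V K 0 z); apply: nearW => y; rewrite big_nil.
case Pi : (P i); last first.
  by apply: near_eq_holo IH; apply: nearW => y; rewrite big_cons Pi.
apply: near_eq_holo (holo_add (HF i) IH).
by apply: nearW => y; rewrite big_cons Pi.
Qed.

Lemma holo_prod (I : Type) (r : seq I) (P : pred I) (F : I -> V -> K) z :
  (forall i, holo_at (F i) z) -> holo_at (fun y => \prod_(i <- r | P i) F i y) z.
Proof.
move=> HF; elim: r => [|i r IH].
  by apply: near_eq_holo (@holo_cst K V K 1 z); apply: nearW => y; rewrite big_nil.
case Pi : (P i); last first.
  by apply: near_eq_holo IH; apply: nearW => y; rewrite big_cons Pi.
apply: near_eq_holo (holo_mul (HF i) IH).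
by apply: nearW => y; rewrite big_cons Pi.
Qed.

Lemma holo_expr f z k : holo_at f z -> holo_at (fun y => f y ^+ k) z.
Proof.
move=> fz; have := @holo_prod _ (index_enum 'I_k) predT (fun=> f) z (fun=> fz).
apply: near_eq_holo; apply: nearW => y.
by rewrite prodr_const card_ord.
Qed.

Lemma holo_det m (F : V -> 'M[K]_m) z :
  (forall i j, holo_at (fun y => F y i j) z) -> holo_at (fun y => \det (F y)) z.
Proof.
move=> HF; rewrite /determinant; apply: holo_sum => s.
apply: holo_mul; first exact: holo_cst.
exact: holo_prod.
Qed.

Lemma holo_comp m (f : V -> 'rV[K]_m) (g : 'rV[K]_m -> K) z :
  holo_at f z -> holo_at g (f z) -> holo_at (fun y => g (f y)) z.
Proof.
move=> fz gz.
have fg : \forall y \near z, holo_at g (f y).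
  exact: near_continuous (holo_at_continuous fz) (holo_at_near gz).
apply: holo_at_intro (filterI (holo_at_near fz) fg) _ => {fz gz fg} y [fy gy].
have [Df cf] := holo_at_C1 fy; have [Dg cg] := holo_at_C1 gy.
split; first exact: (differentiable_comp Df Dg).
move=> v.
have fgy : \forall x \near y, C1_at f x /\ C1_at g (f x).
  apply: filterI (fy) _; exact: near_continuous (holo_at_continuous fy) gy.
have E : \forall x \near y, 'D_v (fun y => g (f y)) x =
   \sum_j 'D_v f x 0 j * 'D_(delta_mx 0 j) g (f x).
  apply: filterS fgy => x [[Dfx _] [Dgx _]].
  rewrite !deriveE//; last exact: (differentiable_comp Dfx Dgx).
  rewrite (diff_comp Dfx Dgx) /= {1}(row_sum_delta ('d f x v)) linear_sum.
  apply: eq_bigr => j _; rewrite linearZ /=; congr (_ * _).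
  by rewrite deriveE.
have c : {for y, continuous (fun x => \sum_j 'D_v f x 0 j * 'D_(delta_mx 0 j) g (f x))}.
  apply: continuous_big_sum => j.
  apply: (@continuousM K V (fun x => 'D_v f x 0 j) (fun x => 'D_(delta_mx 0 j) g (f x))).
    apply: (@continuous_comp _ _ _ (fun x => 'D_v f x) (fun u : 'rV[K]_m => u 0 j)).
      exact: cf.
    exact: coord_continuous.
  apply: (@continuous_comp _ _ _ f (fun u => 'D_(delta_mx 0 j) g u)).
    exact: holo_at_continuous.
  exact: cg.
move/continuous_atP in c; apply/continuous_atP => e e0.
near=> x.
by rewrite (nbhs_singleton E) (near E x)//; near: x; exact: c.
Unshelve. all: by end_near. Qed.

End HoloScalar.

Section HoloRegular.
Variables (R : realType) (n : nat).
Local Notation C := (Cx R).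
Implicit Types (f : 'rV[C]_n -> C).

(** The factor 3 is the room that the regularity argument demands around the point. *)
Lemma near_ball3 (P : 'rV[C]_n -> Prop) (z : 'rV[C]_n) : (\forall y \near z, P y) ->
  exists2 r : C, 0 < r & forall y : 'rV[C]_n, `|y - z| <= 3 * r -> P y.
Proof.
move=> /nbhs_ballP[d /= d0 dP]; exists (d / 4).
  by rewrite divr_gt0// ltr0n.
move=> y yz; apply: dP; rewrite -ball_normE /= distrC.
apply: le_lt_trans yz _.
have -> : 3 * (d / 4) = d - d / 4 by field.
by rewrite ltrBlDr ltrDl divr_gt0// ltr0n.
Qed.

(** Second directional derivatives exist nearby and are continuous, so the partial derivatives
    criterion gives differentiability of the first ones. This is what makes Wronskians
    holomorphic. *)
Lemma holo_derive f z w : holo_at f z -> holo_at (fun y => 'D_w f y) z.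
Proof.
move=> /holo_at_near fz; apply: holo_at_intro (fz) _ => {fz} y fy.
have D x v : holo_at f x -> (\forall u \near x, derivable (fun y => 'D_w f y) u v) /\
   {for x, continuous (fun y => 'D_v (fun y => 'D_w f y) y)}.
  move=> /near_ball3[r r0 fC1]; split; last exact: second_derivative_continuous r0 fC1.
  have [d d0 dP] := quotient_near v w r0 fC1 ltr01.
  have := @near_norm_sub C 'rV[C]_n x r r0; apply: filterS => u xu.
  have [] := dP (d / 2) u (norm_half_lt d0) _ => //.
  by rewrite distrC ltW.
split; last by move=> v; exact: (D _ _ _).2.
apply: differentiable_partials; last by move=> j; exact: (D _ _ _).2.
apply: (@filter_forall 'rV[C]_n 'I_n
  (fun j u => derivable (fun y => 'D_w f y) u (delta_mx 0 j)) (nbhs y) _) => j.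
exact: (D _ _ _).1.
Qed.

(** On the complex line w |-> z + w (z - q) the point [q] sits at w = -1 and [z] at w = 0. For |w|
    <= 3 the distance to [q] is |1 + w| |z - q| <= 4 |z - q|, whence the radius r / 4. *)
Lemma vanish_ball f (q : 'rV[C]_n) (r : C) :
  (forall y, `|y - q| < r -> C1_at f y) -> (\forall y \near q, f y = 0) ->
  forall z, `|z - q| < r / 4 -> f z = 0.
Proof.
move=> fC1 f0 z zq; pose v := z - q.
pose G (w : C) := f (z + w *: v).
pose dG (w : C) := 'D_v f (z + w *: v).
have C1w (w : C) : `|w| <= 3 -> C1_at f (z + w *: v).
  move=> w3; apply: fC1.
  have -> : z + w *: v - q = (1 + w) *: v by rewrite scalerDl scale1r addrAC.
  rewrite normrZ; apply: (@le_lt_trans _ _ (4 * `|v|)).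
    rewrite ler_wpM2r// (le_trans (ler_normD _ _))// normr1.
    by rewrite -[4]/(4%:R) (natrD _ 1 3) lerD2l.
  by rewrite -ltr_pdivlMl ?ltr0n// mulrC.
have := @unique_continuation_line R G dG.
rewrite /G scale0r addr0; apply.
- by move=> w /C1w/C1_line[].
- by move=> w /C1w/C1_line[].
have zv : z + (-1) *: v = q by rewrite scaleN1r /v opprB subrKC.
have f0' : \forall y \near z + (-1) *: v, f y = 0 by rewrite zv.
exact: (@near_continuous _ _ (fun t : C => z + t *: v) _ _ (@continuous_line R _ z v (-1)) f0').
Qed.

End HoloRegular.

(** * Holomorphic functions on a complex manifold *)

Section Manifold.
Variables (R : realType) (n : nat) (M : complex_manifold R n).
Local Notation C := (Cx R).
Implicit Types (f g : M -> C) (c d : cm_idx M) (x : M).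

Lemma near_param c x (P : M -> Prop) : cm_dom c x -> (\forall y \near x, P y) ->
  \forall z \near cm_chart c x, P (cm_param c z).
Proof.
move=> cx Px; apply: (@near_continuous _ _ (cm_param c) (cm_chart c x)).
  by apply: cm_param_continuous; exists x.
by rewrite cm_chartK.
Qed.

Lemma near_chart c x (P : 'rV[C]_n -> Prop) : cm_dom c x ->
  (\forall z \near cm_chart c x, P z) -> \forall y \near x, P (cm_chart c y).
Proof. by move=> cx; apply: near_continuous; exact: cm_chart_continuous. Qed.

Lemma near_dom c x : cm_dom c x -> \forall y \near x, cm_dom c y.
Proof. by move=> cx; apply: open_nbhs_nbhs; split=> //; exact: cm_dom_open. Qed.

Lemma near_image c x : cm_dom c x ->
  \forall z \near cm_chart c x, cm_dom c (cm_param c z) /\ cm_chart c (cm_param c z) = z.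
Proof.
move=> cx; have : nbhs (cm_chart c x) (cm_chart c @` cm_dom c).
  by apply: open_nbhs_nbhs; split; [exact: cm_image_open|exists x].
by apply: filterS => z [y cy <-]; rewrite cm_chartK.
Qed.

Lemma chart_image_open c (W : set M) : open W -> open (cm_chart c @` (cm_dom c `&` W)).
Proof.
move=> oW; rewrite openE => _ [x [cx Wx] <-]; rewrite /interior.
have nW : \forall y \near x, W y by apply: open_nbhs_nbhs.
near=> z; exists (cm_param c z).
  split; first by apply: (near (near_image cx) z _).1.
  by near: z; exact: near_param cx nW.
by apply: (near (near_image cx) z _).2.
Unshelve. all: by end_near. Qed.

Definition hol_at f x := forall c, cm_dom c x -> holo_at (f \o cm_param c) (cm_chart c x).

Lemma hol_at_chart c f x : cm_dom c x ->
  holo_at (f \o cm_param c) (cm_chart c x) -> hol_at f x.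
Proof.
move=> cx fc d dx.
have tr : holo_at (cm_chart c \o cm_param d) (cm_chart d x).
  have /holomorphic_onP := cm_transition (c0 := M) d c.
  move=> /(_ (chart_image_open (cm_dom_open c))); apply.
  by exists x.
have fc' : holo_at (f \o cm_param c) ((cm_chart c \o cm_param d) (cm_chart d x)).
  by rewrite /= (cm_chartK dx).
apply: near_eq_holo (holo_comp tr fc').
have := near_param dx (near_dom cx); apply: filterS => z cz /=.
by rewrite cm_chartK.
Qed.

Lemma holomorphic_fun_onP (W : set M) f : open W ->
  holomorphic_fun_on W f <-> (forall x, W x -> hol_at f x).
Proof.
move=> oW; split=> [H x Wx c cx|H c].
  have /(holomorphic_onP _ (chart_image_open oW)) := H c; apply.
  by exists x.
apply/(holomorphic_onP _ (chart_image_open oW)) => _ [x [cx Wx] <-].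
exact: H.
Qed.

Lemma near_eq_hol f g x : (\forall y \near x, f y = g y) -> hol_at f x -> hol_at g x.
Proof. by move=> fg fx c cx; apply: near_eq_holo (fx c cx); exact: near_param cx fg. Qed.

Lemma hol_at_continuous f x : hol_at f x -> {for x, continuous f}.
Proof.
move=> fx; have [c cx] := cm_cover x.
have /continuous_atP fc := holo_at_continuous (fx c cx).
apply/continuous_atP => e e0.
apply: filterS (filterI (near_dom cx) (near_chart cx (fc e e0))) => y [cy].
by rewrite /= !cm_chartK.
Qed.

Lemma hol_cst (b : C) x : hol_at (fun=> b) x.
Proof. by move=> c cx; exact: holo_cst. Qed.

Lemma hol_mul f g x : hol_at f x -> hol_at g x -> hol_at (fun y => f y * g y) x.
Proof. by move=> fx gx c cx; exact: holo_mul (fx c cx) (gx c cx). Qed.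

Lemma hol_inv f x : f x != 0 -> hol_at f x -> hol_at (fun y => (f y)^-1) x.
Proof.
by move=> fx0 fx c cx; apply: holo_inv (fx c cx); rewrite /= cm_chartK.
Qed.

Lemma hol_expr f x k : hol_at f x -> hol_at (fun y => f y ^+ k) x.
Proof. by move=> fx c cx; exact: holo_expr (fx c cx). Qed.

Lemma hol_sum (I : Type) (r : seq I) (P : pred I) (F : I -> M -> C) x :
  (forall i, hol_at (F i) x) -> hol_at (fun y => \sum_(i <- r | P i) F i y) x.
Proof.
move=> HF c cx.
exact: (@holo_sum _ _ _ _ _ (fun i => F i \o cm_param c)) (fun i => HF i c cx).
Qed.

Lemma hol_prod (I : Type) (r : seq I) (P : pred I) (F : I -> M -> C) x :
  (forall i, hol_at (F i) x) -> hol_at (fun y => \prod_(i <- r | P i) F i y) x.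
Proof.
move=> HF c cx.
exact: (@holo_prod _ _ _ _ _ (fun i => F i \o cm_param c)) (fun i => HF i c cx).
Qed.

Lemma hol_det m (F : M -> 'M[C]_m) x :
  (forall i j, hol_at (fun y => F y i j) x) -> hol_at (fun y => \det (F y)) x.
Proof.
move=> HF c cx.
exact: (@holo_det _ _ _ (F \o cm_param c)) (fun i j => HF i j c cx).
Qed.

Lemma holo_map_at (F : M -> M) c d x : holomorphic_map F -> cm_dom c x -> cm_dom d (F x) ->
  holo_at (cm_chart d \o F \o cm_param c) (cm_chart c x).
Proof.
move=> [cF HF] cx dFx.
have oFd : open (F @^-1` cm_dom d).
  by apply: open_comp; [move=> y _; exact: cF|exact: cm_dom_open].
have /(holomorphic_onP _ (chart_image_open oFd)) := HF c d; apply.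
by exists x.
Qed.

Lemma hol_comp (F : M -> M) f x : holomorphic_map F -> hol_at f (F x) ->
  hol_at (fun y => f (F y)) x.
Proof.
move=> HF fF; have [c cx] := cm_cover x; have [d dx] := cm_cover (F x).
apply: (hol_at_chart cx).
have fc' : holo_at (f \o cm_param d) ((cm_chart d \o F \o cm_param c) (cm_chart c x)).
  by rewrite /= (cm_chartK cx); exact: fF.
apply: near_eq_holo (holo_comp (holo_map_at HF cx dx) fc').
have [cF _] := HF.
have := near_param cx (near_continuous (cF x) (near_dom dx)).
by apply: filterS => z dz /=; rewrite cm_chartK.
Qed.

Section Sections.
Variables (E : bundle_data M) (Eb : holomorphic_line_bundle E).
Implicit Types (s : M -> lb_idx E -> C) (i j : lb_idx E).

Lemma near_lb_dom i x : lb_dom i x -> \forall y \near x, lb_dom i y.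
Proof. by move=> ix; apply: open_nbhs_nbhs; split=> //; exact: lb_open. Qed.

Lemma section_hol s i x : holomorphic_section s -> lb_dom i x -> hol_at (fun y => s y i) x.
Proof.
move=> [_ Hs] ix; have := Hs i; rewrite setTI => /(holomorphic_fun_onP _ (lb_open Eb i)).
exact.
Qed.

Lemma fibre_neq0 x (v : lb_idx E -> C) i j : fibre x v -> v i != 0 -> lb_dom j x -> v j != 0.
Proof.
move=> [v0 vt] vi jx; have ix : lb_dom i x.
  by apply: contrapT => /v0 vi0; rewrite vi0 eqxx in vi.
by move: vi; rewrite (vt i j)// mulf_eq0 negb_or => /andP[].
Qed.

Lemma fibre_eq0 x (v : lb_idx E -> C) i : fibre x v -> lb_dom i x -> v i = 0 ->
  forall j, v j = 0.
Proof.
move=> xv ix vi j; apply/eqP; apply: contraT => vj.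
by have := fibre_neq0 xv vj ix; rewrite vi eqxx.
Qed.

Lemma nonvanishing_open s : holomorphic_section s -> open (nonvanishing_locus s).
Proof.
move=> hs; rewrite openE => x [i si]; rewrite /interior.
have ix : lb_dom i x.
  by apply: contrapT => /((hs.1 x I).1 i) si0; rewrite si0 eqxx in si.
have /continuous_atP/(_ `|s x i|) := hol_at_continuous (section_hol hs ix).
rewrite normr_gt0 => /(_ si); apply: filterS => y yx; exists i.
by apply: contraTneq yx => ->; rewrite subr0 ltxx.
Qed.

(** The identity theorem: the set [Z] of points around which the section vanishes is open and
    closed. If the locus missed a nonempty open set, [Z] would be nonempty, hence all of the
    connected [M]. *)
Lemma nonvanishing_dense s : holomorphic_section s -> nonzero_section s ->
  dense (nonvanishing_locus s).
Proof.
move=> hs [x0 [i0 sx0]] O [x1 Ox1] oO.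
apply: contrapT => O0.
pose Z : set M := [set x | \forall y \near x, forall i, s y i = 0].
suff ZT : Z = [set: M].
  have : Z x0 by rewrite ZT.
  by move=> /nbhs_singleton/(_ i0) s0; rewrite s0 eqxx in sx0.
have := @cm_connected _ _ M; rewrite /connected => /(_ Z); apply.
- exists x1; have : nbhs x1 O by apply: open_nbhs_nbhs.
  apply: filterS => y Oy i; apply/eqP; apply: contraT => si.
  by exfalso; apply: O0; exists y; split=> //; exists i.
- exists Z; last by rewrite setTI.
  by rewrite openE => x; exact: nbhs_interior.
- exists Z; last by rewrite setTI.
  move=> x clZ.
  have [i ix] := lb_cover Eb x; have [c cx] := cm_cover x.
  pose f := (fun y => s y i) \o cm_param c.
  have fx : \forall z \near cm_chart c x, holo_at f z.
    exact: holo_at_near (section_hol hs ix cx).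
  have [r r0 rP] := near_ball3 fx.
  (* A point [y] of [Z] is taken within r / 8 of [x] in the chart: the ball of radius r around its
     image [q] stays within 3 r of [x], and the ball of radius r / 4 around [q], where [f] vanishes,
     contains a neighbourhood of [x]. *)
  have r8 : 0 < r / 8 by rewrite divr_gt0// ltr0n.
  have ir : \forall z \near cm_chart c x, lb_dom i (cm_param c z).
    exact: near_param cx (near_lb_dom ix).
  have H := filterI (near_chart cx (near_norm_sub (cm_chart c x) r8)) (near_dom cx).
  have [y [Zy [yr cy]]] := clZ _ (H (nbhs_filter x)).
  pose q := cm_chart c y.
  have fC1 z : `|z - q| < r -> C1_at f z.
    move=> zq; apply: holo_at_C1; apply: rP.
    apply: le_trans (ler_distD q _ _) _.
    have -> : 3 * r = r + 2 * r by ring.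
    apply: lerD; first exact: ltW.
    rewrite distrC ltW// (lt_trans yr)// ltr_pdivrMr ?ltr0n//.
    have -> : 2 * r * 8 = 16 * r by ring.
    by rewrite ltr_pMl// ltr1n.
  have f0 : \forall z \near q, f z = 0.
    by apply: filterS (near_param cy Zy) => z; exact.
  have V := vanish_ball fC1 f0.
  have fz0 : \forall y \near x, s y i = 0.
    have r4 : `|cm_chart c x - q| < r / 4.
      apply: lt_le_trans yr _; rewrite ler_pM2l// lef_pV2 ?posrE ?ltr0n//.
      by rewrite ler_nat.
    have H1 : \forall z \near cm_chart c x, `|z - q| < r / 4.
      have d0 : 0 < r / 4 - `|cm_chart c x - q| by rewrite subr_gt0.
      apply: filterS (near_norm_sub (cm_chart c x) d0) => z.
      rewrite ltrBrDr distrC; apply: le_lt_trans; exact: ler_distD.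
    apply: filterS (filterI (near_dom cx) (near_chart cx H1)) => u [cu uq].
    by have := V _ uq; rewrite /f /= cm_chartK.
  apply: filterS (filterI (near_lb_dom ix) fz0) => u [iu su].
  exact: fibre_eq0 (hs.1 u I) iu su.
Qed.

End Sections.
End Manifold.

(** * Jets *)

Section RowDerivatives.
Variables (K : numFieldType) (V : normedModType K) (m : nat).
Implicit Types (f : V -> 'rV[K]_m).

Lemma differentiable_row f z : (forall l, differentiable (fun y => f y 0 l) z) ->
  differentiable f z.
Proof.
move=> Df; pose L (u : V) : 'rV[K]_m := \row_l 'd (fun y => f y 0 l) z u.
have linL : linear L.
  by move=> a u v; apply/rowP => l; rewrite !mxE linearP.
pose LM := GRing.isLinear.Build _ _ _ _ L linL.
pose LL : {linear V -> 'rV[K]_m} := HB.pack L LM.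
apply: (@differentiable_of _ _ _ _ LL).
  move=> u; apply: continuous_mx => i l; rewrite (ord1 i).
  rewrite (_ : (fun y => _) = 'd (fun y => f y 0 l) z).
    exact: diff_continuous.
  by apply/funext => y; rewrite /= /L mxE.
move=> e e0.
have H : \forall h \near (0 : V), forall l,
    `|f (z + h) 0 l - f z 0 l - 'd (fun y => f y 0 l) z h| <= e * `|h|.
  apply: (@filter_forall V 'I_m (fun l h =>
    `|f (z + h) 0 l - f z 0 l - 'd (fun y => f y 0 l) z h| <= e * `|h|) (nbhs (0 : V)) _) => l.
  exact: (diff_estimate (Df l)).
apply: filterS (H) => h Hh; apply: mx_norm_le; first by rewrite mulr_ge0// ltW.
by move=> i l; rewrite (ord1 i) /= /L !mxE.
Qed.

Lemma derive_row f z v l : differentiable f z ->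
  'D_v f z 0 l = 'D_v (fun y => f y 0 l) z.
Proof.
move=> Df.
have lin0 : linear (fun u : 'rV[K]_m => u 0 l) by move=> a u w; rewrite !mxE.
pose clM := GRing.isLinear.Build _ _ _ _ (fun u : 'rV[K]_m => u 0 l) lin0.
pose cl : {linear 'rV[K]_m -> K} := HB.pack (fun u : 'rV[K]_m => u 0 l) clM.
have clc : continuous cl by exact: coord_continuous.
have Dl : differentiable cl (f z) by exact: linear_differentiable.
have E : (fun y => f y 0 l) = cl \o f by [].
rewrite !deriveE//; last by rewrite E; exact: differentiable_comp.
by rewrite E (diff_comp Df Dl) /= (diff_lin _ clc).
Qed.

End RowDerivatives.

(** With row vectors, the entry (k, j) of the Jacobian is the k-th partial derivative of the j-th
    component, so Jacobians multiply the derivative part of a jet on the left. *)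
Lemma derive_comp_row (K : numFieldType) n m (f : 'rV[K]_n -> 'rV[K]_m)
    (g : 'rV[K]_m -> K) (z : 'rV[K]_n) (k : 'I_n) :
  differentiable f z -> differentiable g (f z) ->
  'D_(delta_mx 0 k) (g \o f) z = \sum_j jacobian f z k j * 'D_(delta_mx 0 j) g (f z).
Proof.
move=> Df Dg; have Dc := differentiable_comp Df Dg.
rewrite (deriveE _ Dc) (diff_comp Df Dg) /= -(deriveE _ Df) (deriveEjacobian _ Df).
rewrite -rowE {1}(row_sum_delta (row k (jacobian f z))) linear_sum.
apply: eq_bigr => j _; rewrite linearZ /= (deriveE _ Dg).
by congr (_ * _); rewrite /row mxE.
Qed.

Section Blocks.
Variables (K : comNzRingType) (m n p : nat).

Lemma mul_block_id_col (T : 'M[K]_n) (a : 'M[K]_(m, p)) (b : 'M[K]_(n, p)) :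
  block_mx 1%:M 0 0 T *m col_mx a b = col_mx a (T *m b).
Proof. by rewrite mul_block_col mul1mx !mul0mx addr0 add0r. Qed.

Lemma mul_block_scalar_col (f : K) (w : 'M[K]_(n, m)) (a : 'M[K]_(m, p)) (b : 'M[K]_(n, p)) :
  block_mx f%:M 0 w f%:M *m col_mx a b = col_mx (f *: a) (w *m a + f *: b).
Proof. by rewrite mul_block_col !mul_scalar_mx mul0mx addr0. Qed.

End Blocks.

Section Jet.
Variables (K : numFieldType) (n : nat).
Local Notation V := ('rV[K]_n).

Definition pderiv (f : V -> K) (z : V) (k : 'I_n) : K := 'D_(delta_mx 0 k) f z.

Lemma pderiv_mul (f g : V -> K) z k : differentiable f z -> differentiable g z ->
  pderiv (fun y => f y * g y) z k = f z * pderiv g z k + g z * pderiv f z k.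
Proof.
move=> Df Dg; apply: deriveM; exact: diff_derivable.
Qed.

Lemma pderiv_inv (f : V -> K) z k : differentiable f z -> f z != 0 ->
  pderiv (fun y => (f y)^-1) z k = - (f z) ^- 2 * pderiv f z k.
Proof. by move=> Df fz; rewrite /pderiv deriveV//; exact: diff_derivable. Qed.

Lemma pderiv_scale (b : K) (f : V -> K) z k : differentiable f z ->
  pderiv (fun y => b * f y) z k = b * pderiv f z k.
Proof.
move=> Df; have := @deriveZ K V K f b z (delta_mx 0 k); apply.
exact: diff_derivable.
Qed.

Lemma pderiv_sum p (F : 'I_p -> V -> K) z k : (forall j, differentiable (F j) z) ->
  pderiv (fun y => \sum_j F j y) z k = \sum_j pderiv (F j) z k.
Proof.
move=> DF; have -> : (fun y => \sum_j F j y) = \sum_j F j.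
  by apply/funext => y; rewrite fct_sumE.
by apply: derive_sum => j; exact: diff_derivable.
Qed.

Lemma pderiv_near_eq (f g : V -> K) z k : (\forall y \near z, f y = g y) ->
  pderiv f z k = pderiv g z k.
Proof. exact: near_eq_derive. Qed.

Lemma pderiv_comp m (f : V -> 'rV[K]_m) (g : 'rV[K]_m -> K) (z : V) (k : 'I_n) :
  differentiable f z -> differentiable g (f z) ->
  pderiv (fun y => g (f y)) z k =
  \sum_j jacobian f z k j * 'D_(delta_mx 0 j) g (f z).
Proof. exact: derive_comp_row. Qed.

(** Columns are indexed by the functions, so that coordinate changes act from the left and linear
    changes of the functions from the right. For n + 1 functions the determinant is the
    Wronskian. *)
Definition jet_at p (f : 'I_p -> V -> K) (z : V) : 'M[K]_(1 + n, p) :=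
  col_mx (\row_l f l z) (\matrix_(k, l) pderiv (f l) z k).

(* The chain rule on the left, the Leibniz rule on the right. *)
Lemma jet_at_transform p (Psi : V -> V) (z : V) (f g : 'I_p -> V -> K)
    (phi : V -> K) (chi : 'I_p -> K) :
  differentiable Psi z -> (forall l, differentiable (f l) z) ->
  (forall l, differentiable (g l) (Psi z)) -> differentiable phi z ->
  (\forall y \near z, forall l, g l (Psi y) = chi l * (phi y * f l y)) ->
  block_mx 1%:M 0 0 (jacobian Psi z) *m jet_at g (Psi z) =
  block_mx (phi z)%:M 0 (\col_k pderiv phi z k) (phi z)%:M *m jet_at f z
    *m diag_mx (\row_l chi l).
Proof.
move=> DPsi Df Dg Dphi E.
rewrite /jet_at mul_block_id_col mul_block_scalar_col mul_col_mx !mul_mx_diag.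
apply: f_equal2; apply/matrixP => k l.
  by rewrite !mxE (nbhs_singleton E) mulrC.
rewrite [LHS]mxE; under eq_bigr do rewrite [X in _ * X]mxE.
rewrite -(pderiv_comp k DPsi (Dg l)).
have E1 : \forall y \near z, g l (Psi y) = chi l * (phi y * f l y).
  by apply: filterS E => y; exact.
rewrite (pderiv_near_eq _ E1) pderiv_scale; last exact: differentiableM.
rewrite pderiv_mul// !mxE big_ord1 !mxE mulrC; congr (_ * _).
by rewrite addrC [f l z * _]mulrC.
Qed.

Lemma jet_at_colsub p q (h : 'I_q -> 'I_p) (f : 'I_p -> V -> K) z :
  jet_at (fun l => f (h l)) z = colsub h (jet_at f z).
Proof.
apply/matrixP => i l; rewrite [RHS]mxE.
by case: (split_ordP i) => k ->; rewrite ?col_mxEu ?col_mxEd !mxE.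
Qed.

Lemma jet_at_linear p q (P : 'M[K]_(q, p)) (f : 'I_p -> V -> K) (g : 'I_q -> V -> K) z :
  (forall l, differentiable (f l) z) ->
  (forall l y, g l y = \sum_j P l j * f j y) ->
  jet_at g z = jet_at f z *m P^T.
Proof.
move=> Df gE; rewrite /jet_at mul_col_mx; apply: f_equal2; apply/matrixP => i l; rewrite !mxE.
  by rewrite gE; apply: eq_bigr => j _; rewrite !mxE mulrC.
rewrite (_ : g l = fun y => \sum_j P l j * f j y); last by apply/funext => y; rewrite gE.
rewrite pderiv_sum; last by move=> j; apply: differentiableZ.
by apply: eq_bigr => j _; rewrite !mxE pderiv_scale// mulrC.
Qed.

(* In the affine chart [f_j <> 0] the differential of the projective map is
   [f_j^-1 (df - f_j^-1 df_j f)], so its rank is [n] only if the rows of the jet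
   are independent. *)
Lemma jet_at_row_free p (f : 'I_p -> V -> K) (j : 'I_p) z :
  (forall l, differentiable (f l) z) -> f j z != 0 ->
  \rank (jacobian (fun y => \row_l (f l y / f j y)) z) = n ->
  row_free (jet_at f z).
Proof.
move=> Df fj rk.
set Q := (fun y => _) in rk.
pose S : 'rV[K]_p := \row_l f l z.
pose D : 'M[K]_(n, p) := \matrix_(k, l) pderiv (f l) z k.
have QlE l : (fun y => Q y 0 l) = (fun y => f l y * (f j y)^-1).
  by apply/funext => y; rewrite /Q mxE.
have Dinv : differentiable (fun y => (f j y)^-1) z by exact: differentiableV.
have DQ : differentiable Q z.
  by apply: differentiable_row => l; rewrite QlE; exact: differentiableM.
have QE : jacobian Q z = (f j z)^-1 *: (D - (f j z)^-1 *: (col j D *m S)).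
  apply/matrixP => k l.
  have -> : jacobian Q z k l = 'D_(delta_mx 0 k) Q z 0 l.
    by rewrite (deriveEjacobian _ DQ) -rowE [RHS]mxE.
  rewrite (derive_row _ _ DQ) QlE -/(pderiv _ z k) pderiv_mul// pderiv_inv//.
  by rewrite !mxE big_ord1 !mxE; field.
have Qj k : jacobian Q z k j = 0.
  by rewrite QE !mxE big_ord1 !mxE mulrA mulrAC mulVf// mul1r subrr mulr0.
(* A relation between the rows has a coefficient [b0] for the values and a vector [v] for the
   derivatives. Its j-th entry lets [b0] be eliminated, after which [v] kills the Jacobian of [Q],
   of rank n; so v = 0, and b0 = 0 because f_j is nonzero. *)
rewrite -kermx_eq0; apply/rowV0P => u /sub_kermxP.
rewrite -[u]hsubmxK mul_row_col -/S -/D; set b := lsubmx u; set v := rsubmx u.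
rewrite [b]mx11_scalar mul_scalar_mx; set b0 := b 0 0 => bv.
have vD : v *m D = - b0 *: S by rewrite scaleNr; apply/eqP; rewrite -addr_eq0 addrC bv.
have vcol : v *m col j D = (- b0 * f j z)%:M.
  by rewrite colE mulmxA vD -colE; apply/matrixP => i k; rewrite !mxE !ord1 eqxx mulr1n.
have vQ : v *m jacobian Q z = 0.
  rewrite QE -scalemxAr mulmxBr -scalemxAr mulmxA vcol vD mul_scalar_mx scalerA.
  by rewrite mulrCA mulVf// mulr1 subrr scaler0.
have v0 : v = 0.
  apply: (row_free_inj (_ : row_free (jacobian Q z))); first by rewrite /row_free rk.
  by rewrite vQ mul0mx.
have b00 : b0 = 0.
  move: vcol; rewrite v0 mul0mx => /matrixP/(_ 0 0); rewrite !mxE eqxx mulr1n.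
  by move=> /esym/eqP; rewrite mulNr oppr_eq0 mulf_eq0 (negbTE fj) orbF => /eqP.
by rewrite v0 b00 raddf0 row_mx0.
Qed.

End Jet.

Section ManifoldJet.
Variables (R : realType) (n : nat) (M : complex_manifold R n).
Local Notation C := (Cx R).

Definition jet p (c : cm_idx M) (F : 'I_p -> M -> C) (x : M) : 'M[C]_(1 + n, p) :=
  jet_at (fun l => F l \o cm_param c) (cm_chart c x).

Lemma holo_pderiv (f : 'rV[C]_n -> C) z k : holo_at f z -> holo_at (fun y => pderiv f y k) z.
Proof. exact: holo_derive. Qed.

Lemma jet_hol p (c : cm_idx M) (F : 'I_p -> M -> C) (x : M) i l : cm_dom c x ->
  (forall l, hol_at (F l) x) -> hol_at (fun y => jet c F y i l) x.
Proof.
move=> cx HF; apply: (hol_at_chart cx).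
case: (split_ordP i) => k ->.
  apply: near_eq_holo (HF l c cx).
  by apply: filterS (near_image cx) => z [_ cz]; rewrite /= /jet /jet_at col_mxEu mxE /= cz.
apply: near_eq_holo (holo_pderiv k (HF l c cx)).
by apply: filterS (near_image cx) => z [_ cz]; rewrite /= /jet /jet_at col_mxEd mxE /= cz.
Qed.

Lemma det_jet_hol (c : cm_idx M) (F : 'I_(1 + n) -> M -> C) (x : M) : cm_dom c x ->
  (forall l, hol_at (F l) x) -> hol_at (fun y => \det (jet c F y)) x.
Proof. by move=> cx HF; apply: hol_det => i l; exact: jet_hol. Qed.

(** Determinants of [jet_at_transform]: the lower triangular block matrix has n + 1 diagonal entries
    equal to [phi]. Taking [Phi] to be the identity gives the transition rule of the Wronskian,
    taking it in the torus gives invariance. *)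
Lemma det_jet_transform (Phi : M -> M) (c d : cm_idx M) (x : M) (F G : 'I_(1 + n) -> M -> C)
    (phi : M -> C) (chi : 'I_(1 + n) -> C) :
  cm_dom c x -> cm_dom d (Phi x) ->
  {for x, continuous Phi} ->
  differentiable (cm_chart d \o Phi \o cm_param c) (cm_chart c x) ->
  (forall l, hol_at (F l) x) -> (forall l, hol_at (G l) (Phi x)) -> hol_at phi x ->
  (\forall y \near x, forall l, G l (Phi y) = chi l * (phi y * F l y)) ->
  \det (jacobian (cm_chart d \o Phi \o cm_param c) (cm_chart c x)) * \det (jet d G (Phi x)) =
  phi x ^+ n.+1 * (\prod_l chi l) * \det (jet c F x).
Proof.
move=> cx dx cPhi DPhi HF HG Hphi E.
set z := cm_chart c x; set Psi := cm_chart d \o Phi \o cm_param c.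
have zE : Psi z = cm_chart d (Phi x) by rewrite /Psi /= (cm_chartK cx).
have DF l : differentiable (F l \o cm_param c) z by exact: holo_at_diff (HF l c cx).
have DG l : differentiable (G l \o cm_param d) (Psi z).
  by rewrite zE; exact: holo_at_diff (HG l d dx).
have Dphi : differentiable (phi \o cm_param c) z by exact: holo_at_diff (Hphi c cx).
have E1 : \forall y \near z, forall l,
   (G l \o cm_param d) (Psi y) = chi l * ((phi \o cm_param c) y * (F l \o cm_param c) y).
  have E2 := filterI E (near_continuous cPhi (near_dom dx)).
  apply: filterS (near_param cx (E2 (nbhs_filter x))) => y [Ey dy] l.
  by rewrite /Psi /= (cm_chartK dy) Ey.
have := congr1 determinant (jet_at_transform DPhi DF DG Dphi E1).
rewrite !det_mulmx det_ublock det1 mul1r det_lblock !det_scalar det_diag.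
rewrite -/Psi zE /jet => ->.
rewrite /= (cm_chartK cx) -exprD mulrAC; congr (_ * _ * _).
by apply: eq_bigr => l _; rewrite mxE.
Qed.

End ManifoldJet.

(** * Weight sections of the line bundle *)

Section SimultaneousDiagonalisation.
Variables (F : closedFieldType) (n : nat).
Implicit Types (G B : 'M[F]_n.+1).

Lemma horner_undup_eq0 G (rs : seq F) :
  (forall (v : 'rV_n.+1) z, v *m (G - z%:M) *m (G - z%:M) = 0 -> v *m (G - z%:M) = 0) ->
  forall v : 'rV_n.+1, v *m horner_mx G (\prod_(z <- rs) ('X - z%:P)) = 0 ->
  v *m horner_mx G (\prod_(z <- undup rs) ('X - z%:P)) = 0.
Proof.
move=> HG.
have hX z : horner_mx G ('X - z%:P) = G - z%:M.
  by rewrite rmorphB /= horner_mx_X horner_mx_C.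
have hM (p q : {poly F}) (v : 'rV_n.+1) :
    v *m horner_mx G (p * q) = v *m horner_mx G p *m horner_mx G q.
  by rewrite rmorphM /= -mulmxA.
elim: rs => [//|z rs IH] v /=.
rewrite big_cons hM => /IH; rewrite -hM mulrC hM hX => H.
case: ifP => [zrs|_]; last by rewrite big_cons mulrC hM hX.
have zu : z \in undup rs by rewrite mem_undup.
have E : \prod_(x <- undup rs) ('X - x%:P) =
    \prod_(x <- rem z (undup rs)) ('X - x%:P) * ('X - z%:P) :> {poly F}.
  by rewrite (perm_big _ (perm_to_rem zu)) /= big_cons mulrC.
by rewrite E hM hX in H *; exact: HG.
Qed.

(** The minimal polynomial splits over a closed field; by the previous lemma its distinct linear
    factors already annihilate [G]. *)
Lemma semisimple_diagonalizable G :
  (forall (v : 'rV_n.+1) z, v *m (G - z%:M) *m (G - z%:M) = 0 -> v *m (G - z%:M) = 0) ->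
  diagonalizable G.
Proof.
move=> HG; apply/diagonalizableP.
have [rs Drs] := closed_field_poly_normal (mxminpoly G).
have mon : lead_coef (mxminpoly G) = 1 by apply/eqP; exact: mxminpoly_monic.
exists (undup rs); first exact: undup_uniq.
apply: mxminpoly_min; apply/row_matrixP => i; rewrite row0 rowE.
apply: horner_undup_eq0 => //.
by rewrite -[X in horner_mx G X]scale1r -mon -Drs mx_root_minpoly mulmx0.
Qed.

(* The family is replaced by finitely many members spanning the same space. *)
Lemma simultaneous_diagonalisation (T : Type) (S : set T) (P : T -> 'M[F]_n.+1) :
  (forall t u, S t -> S u -> P t *m P u = P u *m P t) ->
  (forall t, S t -> diagonalizable (P t)) ->
  exists2 Q, Q \in unitmx & forall t, S t -> exists d : 'rV_n.+1, Q *m P t = diag_mx d *m Q.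
Proof.
move=> comm diagP.
pose dims k := `[< exists2 As : seq 'M[F]_n.+1,
  (forall B, B \in As -> exists2 t, S t & B = P t) & \dim <<As>>%VS = k >].
have [|k bk|k /asboolP[As AsP dimk] kmax] := @ex_maxnP dims (\dim {:'M[F]_n.+1}).
- by exists 0%N; apply/asboolP; exists [::]; rewrite ?span_nil ?dimv0.
- by move/asboolP: bk => [As _ <-]; exact: dimvS (subvf _).
(* The span of [As] has maximal dimension, so adjoining [P t] cannot enlarge it. *)
have inspan t : S t -> P t \in <<As>>%VS.
  move=> St; have sub : (<<As>> <= <<P t :: As>>)%VS by rewrite span_cons addvSr.
  have : (\dim <<P t :: As>> <= k)%N.
    apply: kmax; apply/asboolP; exists (P t :: As) => // B; rewrite in_cons => /orP[/eqP->|].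
      by exists t.
    exact: AsP.
  rewrite -dimk => le; have /eqP -> : (<<As>> == <<P t :: As>>)%VS by rewrite eqEdim sub.
  by rewrite memv_span// mem_head.
have [|Q Qu /allP QAs] := (codiagonalizableP As).1.
  split=> [B D /AsP[t St ->] /AsP[u Su ->]|B /AsP[t St ->]]; first exact: comm.
  exact: diagP.
exists Q => // t /inspan Pt.
have H i j : i != j -> (Q *m P t *m invmx Q) i j = 0.
  move=> ij; rewrite (@coord_span _ _ _ (in_tuple As) (P t) Pt).
  rewrite mulmx_sumr mulmx_suml summxE big1// => k0 _.
  rewrite -scalemxAr -scalemxAl mxE.
  have /QAs/diagonalizable_forP -> // : As`_k0 \in As by exact: mem_nth.
  by rewrite mulr0.
exists (\row_i (Q *m P t *m invmx Q) i i).
rewrite -[LHS](mulmxKV Qu); congr (_ *m _).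
apply/matrixP => i j; rewrite [RHS]mxE [in RHS]mxE.
by have [->|/H->] := eqVneq i j; rewrite ?mulr1n ?mulr0n.
Qed.

End SimultaneousDiagonalisation.

Section Torus.
Variables (R : realType) (s : nat).
Local Notation C := (Cx R).
Implicit Types t u : 'rV[C]_s.

Definition torus_inv t : 'rV[C]_s := \row_j (t 0 j)^-1.

Lemma torus_inv_torus t : torus t -> torus (torus_inv t).
Proof. by move=> tT j; rewrite mxE normfV tT invr1. Qed.

Lemma torus_mul_torus t u : torus t -> torus u -> torus (torus_mul t u).
Proof. by move=> tT uT j; rewrite mxE normrM tT uT mulr1. Qed.

Lemma torus_one : @torus R s (const_mx 1).
Proof. by move=> j; rewrite mxE normr1. Qed.

Lemma torus_neq0 t j : torus t -> t 0 j != 0.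
Proof. by move=> tT; rewrite -normr_gt0 tT. Qed.

Lemma torus_mulC t u : torus_mul t u = torus_mul u t.
Proof. by apply/rowP => j; rewrite !mxE mulrC. Qed.

Lemma torus_mulVr t : torus t -> torus_mul (torus_inv t) t = const_mx 1.
Proof. by move=> tT; apply/rowP => j; rewrite !mxE mulVf// torus_neq0. Qed.

Lemma torus_mulrV t : torus t -> torus_mul t (torus_inv t) = const_mx 1.
Proof. by move=> tT; rewrite torus_mulC torus_mulVr. Qed.

Lemma torus_invM t u : torus_inv (torus_mul t u) = torus_mul (torus_inv u) (torus_inv t).
Proof. by apply/rowP => j; rewrite !mxE invfM mulrC. Qed.

Lemma torus_compact : compact (@torus R s).
Proof.
have cS : compact [set z : C | `|z| = 1].
  have -> : [set z : C | `|z| = 1] = [set z : C | `|z| <= 1] `&` [set z : C | 1 <= `|z|].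
    apply/seteqP; split=> z /=; first by move=> ->.
    by move=> [z1 z2]; apply/eqP; rewrite eq_le z1 z2.
  apply: compact_closedI; first exact: compact_disc.
  exact/(@closed_codisc C C)/real1.
exact: (@rV_compact C s (fun=> [set z : C | `|z| = 1]) (fun=> cS)).
Qed.

Lemma torus_inv_continuous t : torus t -> {for t, continuous torus_inv}.
Proof.
move=> tT; apply: continuous_mx => i j; rewrite (ord1 i).
rewrite (_ : (fun y => _) = (fun y : 'rV[C]_s => (y 0 j)^-1)); last first.
  by apply/funext => y; rewrite mxE.
apply: (@continuousV C _ (fun y : 'rV[C]_s => y 0 j)); first exact: torus_neq0.
exact: coord_continuous.
Qed.

End Torus.

(** Actions are continuous only relative to the torus, so limits are composed along filters
    restricted to subsets. *)
Lemma cvg_within_comp (X Y Z : topologicalType) (T : set X) (S : set Y) (h : X -> Y)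
    (f : Y -> Z) (x : X) (y : Y) (l : Z) :
  h @ within T (nbhs x) --> y ->
  (\forall x' \near within T (nbhs x), S (h x')) ->
  f @ within S (nbhs y) --> l ->
  (f \o h) @ within T (nbhs x) --> l.
Proof.
move=> hc hS fc P /fc nP.
have H : \forall x' \near within T (nbhs x), S (h x') -> P (f (h x')) by exact: (hc _ nP).
by apply: filterS2 hS H => x' Sx'; exact.
Qed.

Lemma cvg_pair_nbhs (X Y Z : topologicalType) (F : set_system X) (FF : Filter F)
    (f : X -> Y) (g : X -> Z) (y : Y) (z : Z) :
  f @ F --> y -> g @ F --> z -> (fun x => (f x, g x)) @ F --> (y, z).
Proof. exact: cvg_pair. Qed.

Lemma cvg_at_within (X Y : topologicalType) (T : set X) (f : X -> Y) x :
  {for x, continuous f} -> f @ within T (nbhs x) --> f x.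
Proof. by move=> fc P /fc H; exact: (@cvg_within _ (nbhs x) _ T _ H). Qed.

Section LineBundle.
Variables (R : realType) (n : nat) (M : complex_manifold R n).
Variables (L : bundle_data M) (Lb : holomorphic_line_bundle L).
Local Notation C := (Cx R).

Lemma frame_fibre j (x : M) : lb_dom j x -> fibre x (frame (E := L) j x).
Proof.
move=> jx; split=> [i ix|i k ix kx]; rewrite /frame.
  by case: asboolP.
by rewrite !asboolT// lb_cocycle.
Qed.

Lemma fibre_frame j (x : M) (v : lb_idx L -> C) : lb_dom j x -> fibre x v ->
  v = (fun i => v j * frame j x i).
Proof.
move=> jx [v0 vt]; apply/funext => i; rewrite /frame.
case: asboolP => ix; last by rewrite v0// mulr0.
by rewrite (vt i j)// mulrC.
Qed.

Lemma fibre_zero (x : M) : fibre x (fun _ : lb_idx L => 0 : C).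
Proof. by split=> // i j _ _; rewrite mulr0. Qed.

Lemma holomorphic_sectionP (u : M -> lb_idx L -> C) :
  holomorphic_section u <->
  (forall x, fibre x (u x)) /\ (forall i x, lb_dom i x -> hol_at (fun y => u y i) x).
Proof.
split=> [hu|[fu hu]].
  by split=> [x|i x ix]; [exact: hu.1|exact: (section_hol Lb hu)].
split=> [x _|i]; first exact: fu.
rewrite setTI; apply/(holomorphic_fun_onP _ (lb_open Lb i)) => x ix; exact: hu.
Qed.

Variables (s : nat) (a : 'rV[C]_s -> M -> M) (a_action : holomorphic_torus_action a).
Variables (A : 'rV[C]_s -> M -> (lb_idx L -> C) -> (lb_idx L -> C)).
Hypothesis A_lift : lifted_action a A.
Implicit Types (t : 'rV[C]_s) (u : M -> lb_idx L -> C).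

(** The torus acting on sections by t^-1 . u(t x). It is a right action, matching the row vector
    convention for its matrices. *)
Definition pull t u : M -> lb_idx L -> C :=
  fun x => A (torus_inv t) (a t x) (u (a t x)).

Lemma act_invK t x : torus t -> a (torus_inv t) (a t x) = x.
Proof.
move=> tT; rewrite -(ta_mul a_action)//; last exact: torus_inv_torus.
by rewrite torus_mulVr// (ta_one a_action).
Qed.

Lemma lift_zero t x : torus t -> A t x (fun=> 0) = (fun=> 0).
Proof.
move=> tT; have := la_linear A_lift (-1) tT (fibre_zero x) (fibre_zero x).
rewrite (_ : (fun i => -1 * 0 + 0) = (fun=> 0)); last by apply/funext => i; rewrite mulr0 addr0.
by move=> ->; apply/funext => i; rewrite mulN1r addNr.
Qed.

Lemma lift_scale t x b (v : lb_idx L -> C) : torus t -> fibre x v ->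
  A t x (fun i => b * v i) = (fun i => b * A t x v i).
Proof.
move=> tT xv; have := la_linear A_lift b tT xv (fibre_zero x).
rewrite lift_zero// (_ : (fun i => b * v i + 0) = (fun i => b * v i)); last first.
  by apply/funext => i; rewrite addr0.
by move=> ->; apply/funext => i; rewrite addr0.
Qed.

Lemma lift_frame t x j (v : lb_idx L -> C) i : torus t -> lb_dom j x -> fibre x v ->
  A t x v i = A t x (frame j x) i * v j.
Proof.
move=> tT jx xv; rewrite {1}(fibre_frame jx xv) lift_scale//; last exact: frame_fibre.
by rewrite mulrC.
Qed.

Lemma lift_hol t i j x : torus t -> lb_dom i x -> lb_dom j (a t x) ->
  hol_at (fun y => A t y (frame i y) j) x.
Proof.
move=> tT ix jx; have [cF _] := ta_holo a_action tT.
have oW : open (lb_dom i `&` a t @^-1` lb_dom j).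
  apply: openI; first exact: lb_open.
  by apply: open_comp; [move=> y _; exact: cF|exact: lb_open].
have /(holomorphic_fun_onP _ oW) := la_holo A_lift i j tT; apply.
by split.
Qed.

Lemma pull_section t u : torus t -> holomorphic_section u -> holomorphic_section (pull t u).
Proof.
move=> tT /holomorphic_sectionP[fu hu]; have iT := torus_inv_torus tT.
apply/holomorphic_sectionP; split=> [x|i x ix].
  by have := la_fibre A_lift iT (fu (a t x)); rewrite act_invK.
have [j jx] := lb_cover Lb (a t x).
have HF := ta_holo a_action tT.
have h1 : hol_at (fun y => A (torus_inv t) y (frame j y) i) (a t x).
  by apply: lift_hol => //; rewrite act_invK.
apply: near_eq_hol (hol_mul (hol_comp HF h1) (hol_comp HF (hu j _ jx))).
apply: filterS (near_continuous (HF.1 x) (near_lb_dom Lb jx)) => y jy.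
by rewrite -lift_frame.
Qed.

Lemma pull_sum t p (b : 'I_p -> C) (f : 'I_p -> M -> lb_idx L -> C) : torus t ->
  (forall l x, fibre x (f l x)) ->
  pull t (fun x i => \sum_l b l * f l x i) = (fun x i => \sum_l b l * pull t (f l) x i).
Proof.
move=> tT ff; have iT := torus_inv_torus tT; apply/funext => x; rewrite /pull.
have [j jx] := lb_cover Lb (a t x).
apply/funext => i; rewrite (lift_frame _ _ jx)//.
  by rewrite mulr_sumr; apply: eq_bigr => l _; rewrite (lift_frame _ _ jx (ff l _))// mulrCA.
split=> [k kx|k k' kx k'x].
  by rewrite big1// => l _; rewrite (ff l (a t x)).1 ?mulr0.
by rewrite mulr_sumr; apply: eq_bigr => l _; rewrite ((ff l (a t x)).2 k k')// mulrCA.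
Qed.

Lemma pullM t t' u : torus t -> torus t' -> (forall x, fibre x (u x)) ->
  pull (torus_mul t t') u = pull t' (pull t u).
Proof.
move=> tT t'T fu; apply/funext => x; rewrite /pull (ta_mul a_action)//.
rewrite torus_invM (la_mul A_lift) ?act_invK//; exact: torus_inv_torus.
Qed.

Lemma pull1 u : (forall x, fibre x (u x)) -> pull (const_mx 1) u = u.
Proof.
move=> fu; apply/funext => x; rewrite /pull (ta_one a_action).
rewrite (_ : torus_inv _ = const_mx 1) ?(la_one A_lift)//.
by apply/rowP => j; rewrite !mxE invr1.
Qed.

(** Applying [t] to both sides of t^-1 . u(t x) = chi u(x) turns the weight condition into the shape
    required by the jet transformation rule. *)
Lemma weight_act t u chi x i j : torus t -> (forall x, fibre x (u x)) ->
  pull t u = (fun x i => chi * u x i) -> lb_dom i x ->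
  u (a t x) j = chi * (A t x (frame i x) j * u x i).
Proof.
move=> tT fu uE ix; have iT := torus_inv_torus tT.
have E : A t x (pull t u x) = u (a t x).
  rewrite /pull -[X in A t X _](act_invK x tT) -(la_mul A_lift)// torus_mulrV//.
  exact: la_one A_lift _ _ (fu _).
by rewrite -E uE lift_scale// (lift_frame _ _ ix).
Qed.

(** The coordinate is continuous in [t] on the compact torus. A bound at each point and in each
    coordinate suffices later, so no norm on the space of sections is introduced. *)
Lemma pull_bounded u x i : holomorphic_section u -> exists2 B : C, 0 <= B &
  forall t, torus t -> `|pull t u x i| <= B.
Proof.
move=> hu; have /holomorphic_sectionP[fu hu'] := hu.
have [ix|ix] := pselect (lb_dom i x); last first.
  exists 0 => // t tT; have /holomorphic_sectionP[fp _] := pull_section tT hu.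
  by rewrite (fp x).1// normr0.
have gc : {within @torus R s, continuous (fun t => pull t u x i)}.
  apply/subspace_continuousP => t0 t0T.
  change ((fun t => pull t u x i) @ within (@torus R s) (nbhs t0) --> pull t0 u x i).
  have [j jx] := lb_cover Lb (a t0 x).
  pose F := within (@torus R s) (nbhs t0).
  have FF0 : Filter F by exact: within_filter.
  have c1 : (fun t => a t x) @ F --> a t0 x.
    apply: (@cvg_within_comp _ _ _ (@torus R s) [set p : 'rV[C]_s * M | torus p.1]
      (fun t => (t, x)) (fun p => a p.1 p.2) t0 (t0, x)).
    - have FF : Filter (within (@torus R s) (nbhs t0)) by exact: within_filter.
      have e1 : (fun t => t) @ within (@torus R s) (nbhs t0) --> t0 by exact: cvg_within.
      have e2 : (fun=> x) @ within (@torus R s) (nbhs t0) --> x by exact: cvg_cst.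
      exact: (cvg_pair_nbhs FF e1 e2).
    - by rewrite near_withinE; apply: nearW.
    - have /subspace_continuousP/(_ (t0, x) t0T) := ta_continuous a_action; exact.
  have nT : \forall t \near F, torus t by rewrite near_withinE; apply: nearW.
  have nj : \forall t \near F, lb_dom j (a t x) by exact: (c1 _ (near_lb_dom Lb jx)).
  have c2 : (fun t => (torus_inv t, a t x)) @ F --> (torus_inv t0, a t0 x).
    have FF : Filter F by exact: within_filter.
    have e1 : (fun t => torus_inv t) @ F --> torus_inv t0.
      exact: (@cvg_at_within _ _ _ _ _ (torus_inv_continuous t0T)).
    exact: (cvg_pair_nbhs FF e1 c1).
  have c3 : (fun t => A (torus_inv t) (a t x) (frame j (a t x)) i) @ F -->
      A (torus_inv t0) (a t0 x) (frame j (a t0 x)) i.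
    apply: (@cvg_within_comp _ _ _ (@torus R s) [set p : 'rV[C]_s * M |
        [/\ torus p.1, lb_dom j p.2 & lb_dom i (a p.1 p.2)]]
      (fun t => (torus_inv t, a t x)) (fun p => A p.1 p.2 (frame j p.2) i) t0 _ _ c2).
      apply: filterS2 nT nj => t tT jt; split=> //=; first exact: torus_inv_torus.
      by rewrite act_invK.
    have cA := la_continuous (i := j) (j := i) A_lift.
    move/subspace_continuousP : cA => /(_ (torus_inv t0, a t0 x)); apply.
    by split=> //=; [exact: torus_inv_torus|rewrite act_invK].
  have c4 : (fun t => u (a t x) j) @ F --> u (a t0 x) j.
    exact: (cvg_comp _ _ c1 (hol_at_continuous (hu' j _ jx))).
  have c5 : (fun t => A (torus_inv t) (a t x) (frame j (a t x)) i * u (a t x) j) @ F -->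
      A (torus_inv t0) (a t0 x) (frame j (a t0 x)) i * u (a t0 x) j.
    exact: (cvgM c3 c4).
  have E t : torus t -> lb_dom j (a t x) ->
     A (torus_inv t) (a t x) (frame j (a t x)) i * u (a t x) j = pull t u x i.
    by move=> tT jt; rewrite /pull -lift_frame//; exact: torus_inv_torus.
  rewrite -(E _ t0T jx).
  have E2 : \forall t \near F, A (torus_inv t) (a t x) (frame j (a t x)) i * u (a t x) j =
      pull t u x i.
    by apply: filterS (filterI nT nj) => t [tT jt]; exact: E.
  exact: cvg_trans ((@near_eq_cvg _ _ F FF0 _ _ E2)) c5.
have cI : compact ((fun t => pull t u x i) @` @torus R s).
  by apply: continuous_compact => //; exact: torus_compact.
have [|B B0 HB] := @compact_bounded_fun C C C _ id cI.
  by move=> y _; exact: cvg_id.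
by exists B => // t tT; apply: HB; exists t.
Qed.

End LineBundle.

Section BoundedOrbit.
Variable R : realType.
Local Notation C := (Cx R).

Lemma bounded_powers_le1 (x c B : C) : c != 0 -> (forall m, `|x ^+ m * c| <= B) -> `|x| <= 1.
Proof.
move=> c0 H; have [//|x1] := real_leP (normr_real x) (@real1 _).
have x0 : 0 < `|x| by apply: lt_trans x1.
have B0 : 0 <= B by apply: le_trans (H 0%N).
suff /normr0_eq0 : `|c| = 0 by move/eqP; rewrite (negbTE c0).
apply: (@ler_expn_natM R _ `|x|^-1 B) => //.
- by rewrite invf_lt1.
by move=> m; rewrite exprVn ler_pdivlMr ?exprn_gt0// mulrC -normrX -normrM.
Qed.

Lemma bounded_multiples_eq0 (c B : C) : (forall m : nat, `|m%:R * c| <= B) -> c = 0.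
Proof.
move=> H; apply/eqP; apply: contraT => c0; exfalso.
have B0 : 0 <= B by apply: le_trans (H 0%N).
have c1 : 0 < `|c| by rewrite normr_gt0.
have [|m] := @natSinv_lt R (`|c| / (B + 1)); first by rewrite divr_gt0// ltr_wpDl.
rewrite ltr_pdivlMr ?ltr_wpDl// ltr_pdivrMl ?ltr0n// => h.
have := H m.+1; rewrite normrM normr_nat => /(lt_le_trans h).
by move=> /ltW; rewrite gerDl ler10.
Qed.

End BoundedOrbit.

Section WeightBasis.
Variables (R : realType) (n : nat) (M : complex_manifold R n).
Variables (L : bundle_data M) (Lb : holomorphic_line_bundle L).
Local Notation C := (Cx R).
Variables (s : nat) (a : 'rV[C]_s -> M -> M) (a_action : holomorphic_torus_action a).
Variables (A : 'rV[C]_s -> M -> (lb_idx L -> C) -> (lb_idx L -> C)).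
Hypothesis A_lift : lifted_action a A.
Variables (N : nat) (e : 'I_N.+1 -> M -> lb_idx L -> C) (e_basis : H0_basis e).
Implicit Types (t : 'rV[C]_s) (v w : 'rV[C]_N.+1).

Definition combination v : M -> lb_idx L -> C := fun x i => \sum_l v 0 l * e l x i.

Lemma combination_section v : holomorphic_section (combination v).
Proof.
have he l := (holomorphic_sectionP Lb (e l)).1 (e_basis.1 l).
apply/(holomorphic_sectionP Lb); split=> [x|i x ix].
  split=> [i ix|i j ix jx]; first by rewrite /combination big1// => l _; rewrite ((he l).1 x).1// mulr0.
  by rewrite /combination mulr_sumr; apply: eq_bigr => l _; rewrite (((he l).1 x).2 i j)// mulrCA.
by apply: hol_sum => l; apply: hol_mul; [exact: hol_cst|exact: (he l).2].
Qed.

Lemma combination_inj v w : (forall x i, combination v x i = combination w x i) -> v = w.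
Proof.
move=> vw; have [u [uE uU]] := e_basis.2 _ (combination_section v).
by rewrite -(uU v)// -(uU w).
Qed.

Lemma combination_lin (b : C) v w x i :
  combination (b *: v + w) x i = b * combination v x i + combination w x i.
Proof.
rewrite /combination mulr_sumr -big_split; apply: eq_bigr => l _ /=.
by rewrite !mxE mulrDl mulrA.
Qed.

Lemma combination_exists u : holomorphic_section u -> exists v, u = combination v.
Proof.
move=> /(e_basis.2)[v [vE _]]; exists v.
by apply/funext => x; apply/funext => i; exact: vE.
Qed.

Lemma pull_matrix t : torus t -> exists P : 'M[C]_N.+1,
  forall v, pull a A t (combination v) = combination (v *m P).
Proof.
move=> tT.
have ex l : exists w, pull a A t (e l) = combination w.
  by apply: combination_exists; apply: (pull_section Lb a_action A_lift tT); exact: e_basis.1.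
pose P : 'M[C]_N.+1 := \matrix_l projT1 (cid (ex l)).
have PE l : pull a A t (e l) = combination (row l P).
  by rewrite rowK; exact: projT2 (cid (ex l)).
exists P => v; rewrite (pull_sum Lb A_lift)//; last by move=> l x; exact: (e_basis.1 l).1.
apply/funext => x; apply/funext => i; rewrite /combination.
under eq_bigr => l _ do rewrite PE /combination mulr_sumr.
rewrite exchange_big /=; apply: eq_bigr => j _; rewrite mxE mulr_suml.
by apply: eq_bigr => l _; rewrite mxE mulrA.
Qed.

(* A Jordan block of size at least 2, or an eigenvalue off the unit circle, would
   make the orbit of some section under the compact torus unbounded. *)
Lemma weight_basis : exists (Q : 'M[C]_N.+1) (chi : 'rV[C]_s -> 'I_N.+1 -> C),
  Q \in unitmx /\ forall t l, torus t ->
    pull a A t (combination (row l Q)) = (fun x i => chi t l * combination (row l Q) x i).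
Proof.
(* Guarding by [torus t] makes the choice of a matrix total; off the torus it carries no
   information. *)
have ex t : exists P : 'M[C]_N.+1, torus t -> forall v, pull a A t (combination v) = combination (v *m P).
  have [tT|tT] := pselect (torus t); last by exists 0.
  by have [P HP] := pull_matrix tT; exists P.
pose P t := projT1 (cid (ex t)).
have PE t : torus t -> forall v, pull a A t (combination v) = combination (v *m P t).
  exact: projT2 (cid (ex t)).
have fs v x : fibre x (combination v x) by exact: (combination_section v).1.
have PM t u : torus t -> torus u -> P (torus_mul t u) = P t *m P u.
  move=> tT uT; apply/row_matrixP => l; apply: combination_inj => x i.
  rewrite !rowE mulmxA -!PE//; last exact: torus_mul_torus.
  by rewrite (pullM a_action A_lift tT uT).
have P1 : P (const_mx 1) = 1%:M.
  apply/row_matrixP => l; apply: combination_inj => x i.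
  by rewrite !rowE mulmx1 -PE ?(pull1 a_action A_lift)//; exact: torus_one.
have PV t : torus t -> P t *m P (torus_inv t) = 1%:M.
  by move=> tT; rewrite -PM ?torus_mulrV//; exact: torus_inv_torus.
pose tpow t m := iter m (torus_mul t) (const_mx 1).
have tpowT t m : torus t -> torus (tpow t m).
  by move=> tT; elim: m => [|m IH]; [exact: torus_one|exact: torus_mul_torus].
have Ppow t m : torus t -> P (tpow t m) = P t ^+ m.
  move=> tT; elim: m => [|m IH]; first by rewrite P1 expr0.
  by rewrite exprS /= PM ?IH//; exact: tpowT.
have bounded v x i : exists B : C, forall t m, torus t -> `|combination (v *m P t ^+ m) x i| <= B.
  have [B _ HB] := pull_bounded Lb a_action A_lift x i (combination_section v).
  by exists B => t m tT; rewrite -Ppow// -PE; [apply: HB|]; exact: tpowT.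
have secZ b v x i : combination (b *: v) x i = b * combination v x i.
  have := combination_lin b v 0 x i; rewrite addr0 => ->.
  by rewrite [X in _ + X](_ : _ = 0) ?addr0// /combination big1// => l _; rewrite mxE mul0r.
have semis t v z : torus t ->
    v *m (P t - z%:M) *m (P t - z%:M) = 0 -> v *m (P t - z%:M) = 0.
  move=> tT; set w := v *m (P t - z%:M) => w0.
  have wG : w *m P t = z *: w.
    by apply/eqP; rewrite -subr_eq0 -mul_mx_scalar -mulmxBr w0.
  (* If [w] were nonzero, [v] and [w] would span a Jordan block of size 2 for the eigenvalue [z]. *)
  have vG : v *m P t = z *: v + w.
    by rewrite /w mulmxBr mul_mx_scalar addrC subrK.
  apply: contrapT => /eqP wn0.
  have [x [i c0]] : exists x i, combination w x i != 0.
    apply: contrapT => H; move/eqP: wn0; apply; apply: combination_inj => x i.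
    have -> : combination 0 x i = 0 by rewrite /combination big1// => l _; rewrite mxE mul0r.
    by apply/eqP; apply: contraT => wx; exfalso; apply: H; exists x, i.
  have z0 : z != 0.
    apply: contra_neq wn0 => z0; rewrite -[w]mulmx1 -(PV t tT) mulmxA wG z0 scale0r.
    by rewrite mul0mx.
  have wGm m : w *m P t ^+ m = z ^+ m *: w.
    elim: m => [|m IH]; first by rewrite !expr0 scale1r; exact: mulmx1.
    by rewrite exprSr mulmxA IH -scalemxAl wG scalerA exprSr.
  (* Bounded powers of [t] give |z| <= 1; those of the inverse give |z^-1| <= 1. *)
  have wVm m : w *m P (torus_inv t) ^+ m = z^-1 ^+ m *: w.
    have wV : w *m P (torus_inv t) = z^-1 *: w.
      have := congr1 (fun u => z^-1 *: (u *m P (torus_inv t))) wG.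
      by rewrite -mulmxA PV// mulmx1 -scalemxAl scalerA mulVf// scale1r => <-.
    elim: m => [|m IH]; first by rewrite !expr0 scale1r; exact: mulmx1.
    by rewrite exprSr mulmxA IH -scalemxAl wV scalerA exprSr.
  have [B HB] := bounded w x i.
  have z1 : `|z| = 1.
    apply/eqP; rewrite eq_le; apply/andP; split.
      apply: (bounded_powers_le1 c0 (B := B)) => m.
      by rewrite -secZ -wGm; exact: HB.
    rewrite -[`|z|]invrK -normfV invf_ge1 ?normr_gt0 ?invr_eq0//.
    apply: (bounded_powers_le1 c0 (B := B)) => m.
    by rewrite -secZ -wVm; apply: HB; exact: torus_inv_torus.
  (* The coefficient of [w] has modulus m + 1 because |z| = 1, so the orbit of [v] can be bounded
     only if every coordinate of [w] is 0. *)
  have vGm m : v *m P t ^+ m.+1 = z ^+ m.+1 *: v + (m.+1%:R * z ^+ m) *: w.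
    elim: m => [|m IH]; first by rewrite !expr1 expr0 mulr1 scale1r.
    rewrite exprSr mulmxA IH mulmxDl -!scalemxAl vG wG scalerDr !scalerA -exprSr -addrA.
    congr (_ + _); rewrite -scalerDl; congr (_ *: _).
    by rewrite exprS -[in RHS]natr1; ring.
  have [B' HB'] := bounded v x i.
  have B'0 : 0 <= B' by apply: le_trans (HB' t 0%N tT).
  move/eqP: c0; apply; apply: (@bounded_multiples_eq0 _ _ (B' + `|combination v x i|)) => -[|m].
    by rewrite mul0r normr0 addr_ge0.
  have E : z ^+ m * (m.+1%:R * combination w x i) =
      combination (v *m P t ^+ m.+1) x i - z ^+ m.+1 * combination v x i.
    by rewrite vGm combination_lin secZ; ring.
  have E0 : `|m.+1%:R * combination w x i| = `|z ^+ m * (m.+1%:R * combination w x i)|.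
    by rewrite [RHS]normrM normrX z1 expr1n mul1r.
  rewrite E0 E.
  rewrite (le_trans (ler_normB _ _))// lerD ?HB'//.
  by rewrite normrM normrX z1 expr1n mul1r.
have [t u tT uT|t tT|Q Qu HQ] := @simultaneous_diagonalisation C N _ (@torus R s) P.
- by rewrite -!PM// torus_mulC.
- by apply: semisimple_diagonalizable => v z; exact: semis.
pose d t : 'rV[C]_N.+1 := if pselect (torus t) is left tT then projT1 (cid (HQ t tT)) else 0.
exists Q, (fun t l => d t 0 l); split=> // t l tT.
have dE : Q *m P t = diag_mx (d t) *m Q.
  by rewrite /d; case: pselect => // tT'; exact: projT2 (cid (HQ t tT')).
rewrite PE// -row_mul dE row_mul row_diag_mx -scalemxAl -rowE.
by apply/funext => x; apply/funext => i; exact: secZ.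
Qed.

End WeightBasis.

(** * The invariant form *)

Lemma jacobian_id (K : numFieldType) n (f : 'rV[K]_n -> 'rV[K]_n) z :
  (\forall y \near z, f y = y) -> jacobian f z = 1%:M.
Proof.
move=> fE.
have fE' : \forall y \near z, id y = f y by apply: filterS fE => y ->.
have Df : differentiable f z.
  exact: near_eq_differentiable fE' (@linear_differentiable _ _ _ idfun z (fun y => cvg_id)).
apply/row_matrixP => k; rewrite !rowE mulmx1 -deriveEjacobian//.
rewrite -(near_eq_derive _ fE'); exact: derive_id.
Qed.

Section PowerBundle.
Variables (R : realType) (n : nat) (M : complex_manifold R n).
Variables (L : bundle_data M) (Lb : holomorphic_line_bundle L).
Local Notation C := (Cx R).

Lemma power_bundleP k : holomorphic_line_bundle (power_bundle L k).
Proof.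
split=> [i|x|i j x ix jx|i j|i j l x ix jx lx] /=.
- exact: (lb_open Lb).
- exact: (lb_cover Lb).
- by rewrite expf_neq0// (lb_trans_neq0 Lb).
- have oij : open (lb_dom i `&` lb_dom j) by apply: openI; exact: (lb_open Lb).
  apply/(holomorphic_fun_onP _ oij) => x ijx; apply: hol_expr.
  by have /(holomorphic_fun_onP _ oij) H := lb_trans_holo Lb i j; exact: (H x ijx).
- by rewrite -exprMn (lb_cocycle Lb).
Qed.

Lemma lb_trans_id i (x : M) : lb_dom i x -> lb_trans (b := L) i i x = 1.
Proof.
move=> ix; have H := lb_cocycle Lb ix ix ix.
by apply: (mulfI (lb_trans_neq0 Lb ix ix)); rewrite mulr1.
Qed.

Lemma lb_transV i j (x : M) : lb_dom i x -> lb_dom j x ->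
  lb_trans (b := L) i j x * lb_trans j i x = 1.
Proof. by move=> ix jx; rewrite (lb_cocycle Lb)// lb_trans_id. Qed.

Lemma trans_hol i j (x : M) : lb_dom i x -> lb_dom j x -> hol_at (lb_trans (b := L) i j) x.
Proof.
move=> ix jx; have oij : open (lb_dom i `&` lb_dom j) by apply: openI; exact: (lb_open Lb).
by have /(holomorphic_fun_onP _ oij) H := lb_trans_holo Lb i j; exact: H.
Qed.

(** A finite intersection of dense open sets meets every nonempty open set. It shows that products
    of nonzero sections are nonzero. *)
Lemma common_nonvanishing p (F : 'I_p -> M -> lb_idx L -> C) (O : set M) :
  (forall l, holomorphic_section (F l)) -> (forall l, nonzero_section (F l)) ->
  open O -> O !=set0 -> exists2 x, O x & forall l i, lb_dom i x -> F l x i != 0.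
Proof.
move=> hF nF oO O0.
have [x Ox xF] : exists2 x, O x & forall l, l \in enum 'I_p -> nonvanishing_locus (F l) x.
  elim: (enum 'I_p) O oO O0 => [|l r IH] O oO O0.
    by have [x Ox] := O0; exists x.
  have [||x [Ox Flx] xr] := IH (O `&` nonvanishing_locus (F l)).
  - by apply: openI => //; exact: nonvanishing_open.
  - exact: (nonvanishing_dense Lb (hF l) (nF l) O0 oO).
  by exists x => // k; rewrite in_cons => /orP[/eqP->//|]; exact: xr.
exists x => // l i ix; have [|i' Fi'] := xF l; first by rewrite mem_enum.
exact: fibre_neq0 ((hF l).1 x I) Fi' ix.
Qed.

End PowerBundle.

(** The algebra of invariance: [w] is a Wronskian, [p] a product of the sections, [f] the extra
    power of u_0, [t] the Jacobian determinant and [k] the common factor, forced to be nonzero by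
    [p']. *)
Lemma cancel_ratio (K : fieldType) (w w' p p' f f' t k : K) : f != 0 -> f' != 0 -> p' != 0 ->
  t * w' = k * w -> p' = k * p -> w * f / (p * f) = t * (w' * f' / (p' * f')).
Proof.
move=> f0 f'0 p'0 tw pE; have [k0 p0] : k != 0 /\ p != 0.
  by apply/andP; rewrite -negb_or -mulf_eq0 -pE.
have -> : t * (w' * f' / (p' * f')) = (t * w') * f' / (p' * f') by rewrite !mulrA.
by rewrite tw pE; field; rewrite k0 p0 f0 f'0.
Qed.

Section InvariantForm.
Variables (R : realType) (n s : nat) (M : complex_manifold R n).
Variables (L : bundle_data M) (Lb : holomorphic_line_bundle L).
Local Notation C := (Cx R).
Variables (F : 'I_(1 + n) -> M -> lb_idx L -> C).
Hypothesis hF : forall l, holomorphic_section (F l).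
Hypothesis nF : forall l, nonzero_section (F l).

Definition wronskian (c : cm_idx M) (i : lb_idx L) (x : M) : C :=
  \det (jet c (fun l y => F l y i) x).

Variables (x0 : M) (c0 : cm_idx M) (i0 : lb_idx L).
Hypotheses (c0x : cm_dom c0 x0) (i0x : lb_dom i0 x0) (W0 : wronskian c0 i0 x0 != 0).

Let F_hol l i x : lb_dom i x -> hol_at (fun y => F l y i) x.
Proof. exact: section_hol. Qed.

Lemma wronskian_hol c i x : cm_dom c x -> lb_dom i x -> hol_at (wronskian c i) x.
Proof. by move=> cx ix; apply: det_jet_hol => // l; exact: F_hol. Qed.

(** The jet rule for the identity map, with factor g_ji and all weights 1; as g_ij g_ji = 1, the
    power g_ji^(n+1) crosses over as g_ij^(n+1). *)
Lemma wronskian_trans c d i j x : cm_dom c x -> cm_dom d x -> lb_dom i x -> lb_dom j x ->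
  wronskian c i x = \det (jacobian (cm_chart d \o cm_param c) (cm_chart c x)) *
    lb_trans (b := L) i j x ^+ n.+1 * wronskian d j x.
Proof.
move=> cx dx ix jx.
have Dtr : differentiable (cm_chart d \o id \o cm_param c) (cm_chart c x).
  have /(holomorphic_onP _ (chart_image_open (cm_dom_open d))) := cm_transition (c0 := M) c d.
  by move=> H; apply: holo_at_diff; apply: H; exists x.
have E : \forall y \near x, forall l, F l (id y) j = 1 * (lb_trans (b := L) j i y * F l y i).
  apply: filterS (filterI (near_lb_dom Lb ix) (near_lb_dom Lb jx)) => y [iy jy] l.
  by rewrite mul1r /= (((hF l).1 y I).2 j i).
have := @det_jet_transform _ _ M id c d x (fun l y => F l y i) (fun l y => F l y j)
  (lb_trans (b := L) j i) (fun=> 1) cx dx _ Dtr _ _ (trans_hol Lb jx ix) E.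
rewrite big1// mulr1 => T.
rewrite mulrAC -/(wronskian d j x) T; [|exact: cvg_id|by move=> l; exact: F_hol|by move=> l; exact: F_hol].
by rewrite -/(wronskian c i x) mulrAC -exprMn lb_transV// expr1n mul1r.
Qed.

Variable m : nat.

(** The factor F_0^m raises the power of [L] from n + 1 to n + 1 + m. The guard supplies the value 0
    that [fibre] prescribes outside the trivialisation, where the Wronskian means nothing; products
    of coordinates of sections vanish there by themselves. *)
Definition sigma1 (x : M) (p : cm_idx M * lb_idx L) : C :=
  if `[< cm_dom p.1 x /\ lb_dom p.2 x >] then wronskian p.1 p.2 x * F 0 x p.2 ^+ m else 0.

Definition sigma2 (x : M) (i : lb_idx L) : C := (\prod_l F l x i) * F 0 x i ^+ m.

Lemma sigma1E c i x : cm_dom c x -> lb_dom i x ->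
  sigma1 x (c, i) = wronskian c i x * F 0 x i ^+ m.
Proof. by move=> cx ix; rewrite /sigma1 asboolT. Qed.

Lemma sigma1_out c i x : ~ (cm_dom c x /\ lb_dom i x) -> sigma1 x (c, i) = 0.
Proof. by move=> cix; rewrite /sigma1 asboolF. Qed.

Lemma sigma2_out i x : ~ lb_dom i x -> sigma2 x i = 0.
Proof.
by move=> ix; rewrite /sigma2 (bigD1 0)//= ((hF 0).1 x I).1// !mul0r.
Qed.

Lemma sigma1_trans c d i j x : cm_dom c x -> cm_dom d x -> lb_dom i x -> lb_dom j x ->
  sigma1 x (c, i) = \det (jacobian (cm_chart d \o cm_param c) (cm_chart c x)) *
    lb_trans (b := L) i j x ^+ (n.+1 + m) * sigma1 x (d, j).
Proof.
move=> cx dx ix jx; rewrite !sigma1E// (wronskian_trans cx dx ix jx).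
by rewrite (((hF 0).1 x I).2 i j)// exprMn exprD; ring.
Qed.

Lemma sigma2_trans i j x : lb_dom i x -> lb_dom j x ->
  sigma2 x i = lb_trans (b := L) i j x ^+ (n.+1 + m) * sigma2 x j.
Proof.
move=> ix jx; rewrite /sigma2.
under eq_bigr => l _ do rewrite (((hF l).1 x I).2 i j)//.
rewrite big_split /= prodr_const card_ord (((hF 0).1 x I).2 i j)// exprMn.
by rewrite [in RHS]exprD -[(1 + n)%N]/(n.+1); ring.
Qed.

Lemma sigma1_hol c i x : cm_dom c x -> lb_dom i x -> hol_at (fun y => sigma1 y (c, i)) x.
Proof.
move=> cx ix; apply: near_eq_hol (hol_mul (wronskian_hol cx ix) (hol_expr m (F_hol 0 ix))).
by apply: filterS (filterI (near_dom cx) (near_lb_dom Lb ix)) => y [cy iy]; rewrite sigma1E.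
Qed.

Lemma sigma2_hol i x : lb_dom i x -> hol_at (fun y => sigma2 y i) x.
Proof.
move=> ix; apply: hol_mul (hol_expr m (F_hol 0 ix)).
by apply: hol_prod => l; exact: F_hol.
Qed.

Lemma sigma1_section :
  @holomorphic_section R n M (tensor_bundle (canonical_bundle M) (power_bundle L (n.+1 + m))) sigma1.
Proof.
split=> [x _|[c i]].
  split=> [[c i]|[c i] [d j] [cx ix] [dx jx]] /=; first exact: sigma1_out.
  exact: sigma1_trans.
have oci : open ([set: M] `&` (cm_dom c `&` lb_dom i)).
  by rewrite setTI; apply: openI; [exact: cm_dom_open|exact: (lb_open Lb)].
apply/(holomorphic_fun_onP _ oci) => x [_ [cx ix]]; exact: sigma1_hol.
Qed.

Lemma sigma2_section : @holomorphic_section R n M (power_bundle L (n.+1 + m)) sigma2.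
Proof.
split=> [x _|i].
  by split=> [i|i j ix jx]; [exact: sigma2_out|exact: sigma2_trans].
rewrite setTI; apply/(holomorphic_fun_onP _ (lb_open Lb i)) => x ix; exact: sigma2_hol.
Qed.

Lemma sigma1_nonzero :
  @nonzero_section R n M (tensor_bundle (canonical_bundle M) (power_bundle L (n.+1 + m))) sigma1.
Proof.
have W0' : \forall x \near x0, wronskian c0 i0 x != 0.
  have /continuous_atP/(_ `|wronskian c0 i0 x0|) := hol_at_continuous (wronskian_hol c0x i0x).
  rewrite normr_gt0 => /(_ W0); apply: filterS => y.
  by apply: contraTneq => ->; rewrite subr0 ltxx.
(* F_0 may vanish at [x0], so one moves to a nearby point where the Wronskian is still nonzero. *)
pose S : set M := [set x | [/\ wronskian c0 i0 x != 0, cm_dom c0 x & lb_dom i0 x]].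
have Sx0 : S^° x0.
  rewrite /interior /=.
  by apply: filterS (filterI W0' (filterI (near_dom c0x) (near_lb_dom Lb i0x))) => y [? []].
have [|x Sx xF] := common_nonvanishing Lb hF nF (@open_interior _ S); first by exists x0.
have [Wx cx ix] := interior_subset Sx.
by exists x, (c0, i0); rewrite sigma1E// mulf_neq0// expf_neq0// xF.
Qed.

Lemma sigma2_nonzero : @nonzero_section R n M (power_bundle L (n.+1 + m)) sigma2.
Proof.
have [|x _ xF] := common_nonvanishing Lb hF nF openT; first by exists x0.
have [i ix] := lb_cover Lb x; exists x, i.
rewrite mulf_neq0 ?expf_neq0 ?xF//.
by apply/prodf_neq0 => l _; exact: xF.
Qed.

Let idx x : lb_idx L := projT1 (cid (lb_cover Lb x)).

(** The trivialisation [idx x] is an arbitrary choice, in no way continuous in [x]; holomorphy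
    becomes visible only after [sigmaE] replaces it by a fixed one. *)
Definition sigma (x : M) (c : cm_idx M) : C := sigma1 x (c, idx x) / sigma2 x (idx x).

Local Notation D := (@nonvanishing_locus R n M (power_bundle L (n.+1 + m)) sigma2).

Lemma idxP x : lb_dom (idx x) x.
Proof. exact: projT2 (cid (lb_cover Lb x)). Qed.

Lemma sigma2_neq0 x i : D x -> lb_dom i x -> sigma2 x i != 0.
Proof.
move=> [j xj] ix.
exact: (@fibre_neq0 _ _ _ (power_bundle L (n.+1 + m)) x (sigma2 x) j i (sigma2_section.1 x I) xj ix).
Qed.

(** Numerator and denominator change by the same power of the transition function of [L], and the
    Jacobian of a chart against itself is 1. *)
Lemma sigmaE x c i : D x -> lb_dom i x -> sigma x c = sigma1 x (c, i) / sigma2 x i.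
Proof.
move=> Dx ix; rewrite /sigma; have ix' := idxP x; move: (idx x) ix' => i' ix'.
have [cx|cx] := pselect (cm_dom c x); last by rewrite !sigma1_out ?mul0r// => -[].
rewrite (sigma1_trans cx cx ix ix') (sigma2_trans ix ix').
rewrite jacobian_id ?det1 ?mul1r; last first.
  by apply: filterS (near_image cx) => y [].
have t0 : lb_trans (b := L) i i' x ^+ (n.+1 + m) != 0 by rewrite expf_neq0// (lb_trans_neq0 Lb).
have s0 : sigma2 x i' != 0 by exact: sigma2_neq0.
by rewrite [in RHS]invfM mulrACA divff// mul1r.
Qed.

Lemma sigma_fibre x : D x -> @fibre R n M (canonical_bundle M) x (sigma x).
Proof.
move=> Dx; have ix := idxP x; split=> [c cx|c d cx dx].
  by rewrite (sigmaE c Dx ix) sigma1_out ?mul0r// => -[].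
rewrite !(sigmaE _ Dx ix) (sigma1_trans cx dx ix ix) lb_trans_id// expr1n mulr1.
by rewrite mulrA.
Qed.

Lemma sigma_quotient :
  @is_section_quotient R n M (canonical_bundle M) (power_bundle L (n.+1 + m)) sigma sigma1 sigma2.
Proof.
move=> x Dx; split; first exact: sigma_fibre.
apply/funext => -[c i]; rewrite /tensor /=.
have [ix|ix] := pselect (lb_dom i x); last by rewrite sigma2_out// mulr0 sigma1_out// => -[].
by rewrite (sigmaE c Dx ix) divfK// sigma2_neq0.
Qed.

Lemma D_open : open D.
Proof. exact: (@nonvanishing_open R n M _ (power_bundleP Lb (n.+1 + m)) _ sigma2_section). Qed.

Lemma D_dense : dense D.
Proof. exact: (@nonvanishing_dense R n M _ (power_bundleP Lb (n.+1 + m)) _ sigma2_section sigma2_nonzero). Qed.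

Lemma sigma_hol x c : D x -> cm_dom c x -> hol_at (fun y => sigma y c) x.
Proof.
move=> Dx cx; have ix := idxP x.
apply: near_eq_hol (hol_mul (sigma1_hol cx ix) (hol_inv (sigma2_neq0 Dx ix) (sigma2_hol ix))).
have nD : \forall y \near x, D y by apply: open_nbhs_nbhs; split=> //; exact: D_open.
by apply: filterS (filterI nD (near_lb_dom Lb ix)) => y [Dy iy]; rewrite (sigmaE c Dy iy).
Qed.

Lemma sigma_meromorphic : @meromorphic_section R n M (canonical_bundle M) D sigma.
Proof.
split; [exact: D_open|exact: D_dense| |].
  split=> [x|c]; first exact: sigma_fibre.
  have oc : open (D `&` cm_dom c) by apply: openI; [exact: D_open|exact: cm_dom_open].
  by apply/(holomorphic_fun_onP _ oc) => x [Dx cx]; exact: sigma_hol.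
move=> c p cp; have ip := idxP p; set i := idx p in ip.
have oci : open (cm_dom c `&` lb_dom i).
  by apply: openI; [exact: cm_dom_open|exact: (lb_open Lb)].
(* The local fraction is the pair of coordinates of [sigma1] and [sigma2]; density of the
   nonvanishing locus keeps the denominator from vanishing on an open set. *)
exists (cm_dom c `&` lb_dom i), (fun y => sigma1 y (c, i)), (fun y => sigma2 y i).
split.
- exact: oci.
- by split.
- by move=> x [].
- split; apply/(holomorphic_fun_onP _ oci) => x [cx ix].
    exact: sigma1_hol.
  exact: sigma2_hol.
split=> [U openU U0 sub|x [cx ix] Dx].
  have [x [Ux Dx]] := D_dense U0 openU; exists x; first exact: Ux.
  by have [_ ix] := sub x Ux; exact: sigma2_neq0.
by rewrite (sigmaE c Dx ix) mulrC divfK// sigma2_neq0.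
Qed.

Variables (a : 'rV[C]_s -> M -> M) (a_action : holomorphic_torus_action a).
Variables (A : 'rV[C]_s -> M -> (lb_idx L -> C) -> (lb_idx L -> C)).
Hypothesis A_lift : lifted_action a A.
Variable chi : 'rV[C]_s -> 'I_(1 + n) -> C.
Hypothesis F_weight : forall t l, torus t ->
  pull a A t (F l) = (fun x i => chi t l * F l x i).

(** Both the Wronskian, corrected by the Jacobian determinant, and the product of the F_l acquire
    phi^(n+1) times the product of the weights. The power of F_0 cancels separately at [x] and at
    [a t x]. *)
Lemma sigma_invariant : invariant_form a D sigma.
Proof.
move=> t x tT Dx Datx c d cx dx.
have ix := idxP x; have jx := idxP (a t x); set i := idx x in ix; set j := idx (a t x) in jx.
have Ft l y : lb_dom i y -> F l (a t y) j = chi t l * (A t y (frame i y) j * F l y i).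
  move=> iy; apply: (weight_act Lb a_action A_lift) => //; last exact: F_weight.
  by move=> z; exact: (hF l).1.
have at_hol := ta_holo a_action tT.
have Dat := holo_at_diff (holo_map_at at_hol cx dx).
have phi_hol := lift_hol Lb a_action A_lift tT ix jx.
have E : \forall y \near x, forall l, F l (a t y) j = chi t l * (A t y (frame i y) j * F l y i).
  by apply: filterS (near_lb_dom Lb ix) => y iy l; exact: Ft.
pose phi := A t x (frame i x) j.
pose T := \det (jacobian (cm_chart d \o a t \o cm_param c) (cm_chart c x)).
have TW : T * wronskian d j (a t x) = phi ^+ n.+1 * (\prod_l chi t l) * wronskian c i x.
  exact: (@det_jet_transform _ _ M (a t) c d x (fun l y => F l y i) (fun l y => F l y j)
    (fun y => A t y (frame i y) j) (chi t) cx dx (at_hol.1 x) Dat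
    (fun l => F_hol l ix) (fun l => F_hol l jx) phi_hol E).
have S1 : \prod_l F l (a t x) j = phi ^+ n.+1 * (\prod_l chi t l) * \prod_l F l x i.
  under eq_bigr => l _ do rewrite Ft//.
  by rewrite !big_split /= prodr_const card_ord -/phi; ring.
have D1 := sigma2_neq0 Dx ix; have D2 := sigma2_neq0 Datx jx.
rewrite (sigmaE c Dx ix) (sigmaE d Datx jx) !sigma1E//.
move: D1 D2; rewrite /sigma2 !mulf_eq0 !negb_or => /andP[P1 Q1] /andP[P2 Q2].
exact: (cancel_ratio Q1 Q2 P2 TW S1).
Qed.

End InvariantForm.

Lemma row_free_minor (K : fieldType) (m p : nat) (J : 'M[K]_(m, p)) : row_free J ->
  exists f : 'I_m -> 'I_p, \det (colsub f J) != 0.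
Proof.
move=> Jf; have JT : row_full J^T by rewrite /row_full mxrank_tr.
exists (fullrankfun JT); have := fullrowsub_unit JT.
rewrite unitmxE unitfE -det_tr; congr (\det _ != 0).
by apply/matrixP => i j; rewrite !mxE.
Qed.

Section WeightSections.
Variables (R : realType) (n s : nat) (M : complex_manifold R n).
Variables (L : bundle_data M) (Lb : holomorphic_line_bundle L).
Local Notation C := (Cx R).

(** The immersion condition makes the rows of the jet of [e] independent. Passing to the basis given
    by [Q] multiplies the jet by an invertible matrix on the right, so some maximal minor is
    nonzero, and its columns select the sections. *)
Lemma wronskian_ex (N : nat) (e : 'I_N.+1 -> M -> lb_idx L -> C) (Q : 'M[C]_N.+1)
    (c : cm_idx M) (i : lb_idx L) (x : M) (j : 'I_N.+1) :
  (forall l, holomorphic_section (e l)) -> Q \in unitmx ->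
  cm_dom c x -> lb_dom i x -> e j x i != 0 ->
  \rank (jacobian (fun z => \row_l (e l (cm_param c z) i / e j (cm_param c z) i))
    (cm_chart c x)) = n ->
  exists f : 'I_(1 + n) -> 'I_N.+1,
    wronskian (fun l => combination e (row (f l) Q)) c i x != 0.
Proof.
move=> he Qu cx ix ej rk.
pose g l := (fun y : M => e l y i) \o cm_param c.
have Dg l : differentiable (g l) (cm_chart c x).
  exact: holo_at_diff (section_hol Lb (he l) ix cx).
have gj : g j (cm_chart c x) != 0 by rewrite /g /= (cm_chartK cx).
have Jf : row_free (jet_at g (cm_chart c x)) := jet_at_row_free Dg gj rk.
pose h l := (fun y : M => combination e (row l Q) y i) \o cm_param c.
have hE l y : h l y = \sum_k Q l k * g k y.
  by rewrite /h /g /= /combination; apply: eq_bigr => k _; rewrite mxE.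
have Jh : row_free (jet_at h (cm_chart c x)).
  rewrite (jet_at_linear Dg hE) /row_free mxrankMfree//.
  by rewrite row_free_unit unitmx_tr.
have [f Hf] := row_free_minor Jh; exists f.
rewrite /wronskian /jet; move: Hf; rewrite -jet_at_colsub; exact.
Qed.

End WeightSections.

Theorem theorem1 (R : realType) (n s : nat) (M : complex_manifold R n)
    (M_compact : compact [set: M]%classic)
    (a : 'rV[Cx R]_s -> M -> M)
    (a_action : holomorphic_torus_action a)
    (a_effective : effective_action a)
    (L : bundle_data M)
    (L_bundle : holomorphic_line_bundle L)
    (L_ample : very_ample L)
    (A : 'rV[Cx R]_s -> M -> (lb_idx L -> Cx R) -> (lb_idx L -> Cx R))
    (A_lift : lifted_action a A) :
  exists k0 : nat, forall k : nat, (k0 <= k)%N ->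
  exists (sigma1 : M ->
            lb_idx (tensor_bundle (canonical_bundle M) (power_bundle L k)) ->
            Cx R)
         (sigma2 : M -> lb_idx (power_bundle L k) -> Cx R)
         (sigma : M -> lb_idx (canonical_bundle M) -> Cx R),
  [/\ holomorphic_section sigma1 /\ nonzero_section sigma1,
      holomorphic_section sigma2 /\ nonzero_section sigma2,
      is_section_quotient sigma sigma1 sigma2,
      meromorphic_section (nonvanishing_locus sigma2) sigma
    & invariant_form a (nonvanishing_locus sigma2) sigma].
Proof.
have [N [e [e_basis e_neq0 _ e_imm]]] := L_ample.
have [Q [chi [Qu Qchi]]] := weight_basis L_bundle a_action A_lift e_basis.
(* Any point will do, since very ampleness gives an immersion everywhere. *)
have [x0 _] := cm_nonempty M.
have [c0 c0x] := cm_cover x0.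
have [j [i0 ej]] := e_neq0 x0.
have i0x : lb_dom i0 x0.
  by apply: contrapT => /(((e_basis.1 j).1 x0 I).1 i0) e0; rewrite e0 eqxx in ej.
have [f W0] := wronskian_ex L_bundle e_basis.1 Qu c0x i0x ej (e_imm x0 c0 i0 j c0x i0x ej).
pose F l := combination e (row (f l) Q).
have hF l : holomorphic_section (F l) by exact: combination_section.
(* A row of an invertible matrix is nonzero, and coordinates in the basis [e] are unique. *)
have nF l : nonzero_section (F l).
  apply: contrapT => F0; have : row (f l) Q != 0.
    apply: contraTneq Qu => Q0; rewrite -row_free_unit -kermx_eq0.
    apply/rowV0Pn; exists (delta_mx 0 (f l)); first by apply/sub_kermxP; rewrite -rowE.
    apply/eqP => /matrixP/(_ 0 (f l)); rewrite !mxE !eqxx; exact/eqP/oner_neq0.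
  move/eqP; apply; apply: (combination_inj L_bundle e_basis) => x i.
  have -> : combination e 0 x i = 0 by rewrite /combination big1// => k _; rewrite mxE mul0r.
  by apply/eqP; apply: contraT => Fx; exfalso; apply: F0; exists x, i.
have F_weight t l : torus t -> pull a A t (F l) = (fun x i => chi t (f l) * F l x i).
  exact: Qchi.
(* The Wronskian of n + 1 sections accounts for n + 1 factors of [L]; the remaining m = k - (n + 1)
   come from the power of u_0. *)
exists n.+1 => k nk.
have [m ->] : exists m, k = (n.+1 + m)%N by exists (k - n.+1)%N; rewrite subnKC.
exists (sigma1 F m), (sigma2 F m), (sigma L_bundle F m); split.
- split; first exact: sigma1_section.
  exact: (sigma1_nonzero L_bundle hF nF c0x i0x W0).
- split; first exact: sigma2_section.
  exact: (sigma2_nonzero L_bundle hF nF).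
- exact: sigma_quotient.
- exact: (sigma_meromorphic L_bundle hF nF).
- exact: (sigma_invariant L_bundle hF a_action A_lift F_weight).
Qed.
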